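(* Let $X$ be a Banach space. Then there exists a rectangular exceedingly rich family $\mathcal{S}$ of closed linear subspaces of $X\times X^*$ such that for every $V\times W\in\mathcal{S}$ (where $V\subset X$, $W\subset X^*$) the following hold: $V$ is an almost isometric ideal in $X$, and there is a contractive linear projection $P:X^*\to X^*$ (that is, $P^2=P$ and $\|P\|\le 1$) with $\ker P=V^\perp$ and $\operatorname{Rng}P\supset W$.
   Context: Banach spaces are over $\mathbb{R}$; $X^*$ carries the norm topology and $X\times X^*$ the product topology. For $V\subset X$, $V^\perp=\{x^*\in X^*: x^*|_V\equiv 0\}$. For a topological space $Z$, $\operatorname{dens}Z$ is the least cardinality of a dense subset, and $\omega$ is the first infinite cardinal. A nonempty family $\mathcal{A}$ of sets is up-directed if for all $A,B\in\mathcal{A}$ there is $C\in\mathcal{A}$ with $A\cup B\subset C$. A family $\mathcal{S}$ of closed subsets of a topological space $Z$ is exceedingly rich if: (R-a) for every $Y\subset Z$ there is $S\in\mathcal{S}$ with $Y\subset S$ and $\max\{\operatorname{dens}Y,\omega\}=\max\{\operatorname{dens}S,\omega\}$; (R-b) if $\mathcal{A}\subset\mathcal{S}$ is up-directed, then $\overline{\bigcup\mathcal{A}}\in\mathcal{S}$. A family $\mathcal{S}$ of subsets of a product $X\times Y$ is rectangular if every $S\in\mathcal{S}$ is of the form $S=A\times B$ with $A\subset X$, $B\subset Y$. A closed subspace $Y$ of a Banach space $X$ is an almost isometric ideal in $X$ if for every finite-dimensional subspace $E\subset X$ and every $\varepsilon>0$ there is a bounded linear operator $T:E\to Y$ such that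 $Tx=x$ for $x\in E\cap Y$ and $(1+\varepsilon)^{-1}\|x\|\le\|Tx\|\le(1+\varepsilon)\|x\|$ for every $x\in E$. *)

(* Defs.v *)
From HB Require Import structures.
From mathcomp Require Import all_boot all_order all_algebra.
From mathcomp Require Import all_classical all_reals all_analysis.

Set Implicit Arguments.
Unset Strict Implicit.
Unset Printing Implicit Defensive.

Import Order.TTheory GRing.Theory Num.Theory.
Import numFieldNormedType.Exports.

Local Open Scope classical_set_scope.
Local Open Scope ring_scope.
Local Open Scope card_scope.

(* Cardinals are represented by sets and compared up to [cardinal_eq]. *)
Record cardinal := Cardinal { card_carrier : Type; card_set : set card_carrier }.

Arguments card_set : clear implicits.

Definition cardinal_eq (a b : cardinal) : Prop := card_set a #= card_set b.

Definition cardinal_max (a b : cardinal) : cardinal :=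
  if card_set a #<= card_set b then b else a.

Definition omega : cardinal := Cardinal [set: nat].

Lemma ex_least_card (T : Type) (P : set (set T)) : P !=set0 ->
  exists D, P D /\ forall E, P E -> D #<= E.
Proof.
move=> [D0 PD0].
pose Q (S : set (set T -> T)) := forall D, P D ->
  (forall g, S g -> D (g D)) /\ (forall g h, S g -> S h -> g D = h D -> g = h).
have [|S [QS maxS]] := @Zorn_bigcup _ Q.
  move=> F FQ Ftot D PD; split.
    by move=> g [S FS Sg]; apply: (FQ _ FS _ PD).1.
  move=> g h [S FS Sg] [S' FS' Sh].
  have [SS'|S'S] := Ftot _ _ FS FS'.
    by apply: (FQ _ FS' _ PD).2 => //; apply: SS'.
  by apply: (FQ _ FS _ PD).2 => //; apply: S'S.
have [[D [PD DS]]|H] := pselect (exists D, P D /\ D `<=` (fun g => g D) @` S).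
  exists D; split=> // E PE; apply: (card_le_trans (subset_card_le DS)).
  apply: (card_le_trans (card_image_le _ _)).
  have /card_eqPle[_ SE] : (fun g => g E) @` S #= S.
    apply: inj_card_eq => g h /set_mem Sg /set_mem Sh; exact: (QS _ PE).2.
  apply: (card_le_trans SE); apply: subset_card_le => _ [g Sg <-].
  exact: (QS _ PE).1.
exfalso.
have pickD D : exists z : T, P D -> D z /\ ~ ((fun g => g D) @` S) z.
  have [PD|nPD] := pselect (P D); last first.
    have [[z _]|Tempty] := pselect (exists z : T, True); first by exists z.
    by exfalso; apply: H; exists D0; split => // z; case: Tempty; exists z.
  have : ~ D `<=` (fun g => g D) @` S by move=> DS; apply: H; exists D.
  by move=> /existsNP[z /not_implyP[Dz nz]]; exists z.
have [g0 g0P] := choice pickD.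
apply: (maxS (S `|` [set g0])).
  split; first by move=> g Sg; left.
  move=> /(_ g0 (or_intror erefl)) Sg0.
  by have [_ []] := g0P _ PD0; exists g0.
move=> D PD; have [g0D g0S] := g0P _ PD; split.
  by move=> g [Sg|->] //; apply: (QS _ PD).1.
move=> g h [Sg|->] [Sh|->] //.
- exact: (QS _ PD).2.
- by move=> e; case: g0S; exists g.
- by move=> e; case: g0S; exists h.
Qed.

Definition least_dense (Z : topologicalType) (D : set Z) : Prop :=
  dense D /\ forall E : set Z, dense E -> D #<= E.

(* The default [set0] is never used, see [dens_least]. *)
Definition dens (Z : topologicalType) : cardinal :=
  Cardinal (xget set0 [set D : set Z | least_dense D]).

Lemma dens_least (Z : topologicalType) : least_dense (card_set (dens Z)).
Proof.
rewrite /dens /=.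
have [|D [dD minD]] := @ex_least_card Z [set D | dense D].
  by exists setT => O O0 _; rewrite setIT.
by case: xgetP => [E _ //|/(_ D)]; case; split.
Qed.

Definition up_directed (T : Type) (A : set (set T)) : Prop :=
  A !=set0 /\
  forall B C, A B -> A C -> exists2 D, A D & B `|` C `<=` D.

(* [set_type Y] is Y with the topology induced by Z. *)
Definition exceedingly_rich (Z : topologicalType) (S : set (set Z)) : Prop :=
  [/\ forall A, S A -> closed A,
      forall Y : set Z, exists A : set Z,
        [/\ S A, Y `<=` A &
            cardinal_eq (cardinal_max (dens (set_type Y)) omega)
                        (cardinal_max (dens (set_type A)) omega)] &
      forall A : set (set Z), A `<=` S -> up_directed A ->
        S (closure (\bigcup_(B in A) B))].

Definition rectangular (T U : Type) (S : set (set (T * U))) : Prop :=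
  forall A, S A -> exists (B : set T) (C : set U), A = B `*` C.

Section subspaces.
Variables (R : realType).

Definition linear_subspace (V : lmodType R) (A : set V) : Prop :=
  submod_closed [in A].

Definition findim_subspace (V : lmodType R) (E : set V) : Prop :=
  exists (n : nat) (e : 'I_n -> V),
    E = [set \sum_(i < n) c i *: e i | c in [set: 'I_n -> R]].

Lemma findim_subspace_linear (V : lmodType R) (E : set V) :
  findim_subspace E -> linear_subspace E.
Proof.
move=> [n [e ->]]; split.
  by rewrite inE; exists (fun=> 0) => //; apply: big1 => i _; rewrite scale0r.
move=> a u v; rewrite !inE => -[c _ <-] [d _ <-].
exists (fun i => a * c i + d i) => //.
rewrite scaler_sumr -big_split /=; apply: eq_bigr => i _.
by rewrite scalerDl scalerA.
Qed.

(* A map on E is encoded by a map on the whole of X; values off E are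
   irrelevant. *)
Definition bounded_linear_on (X : normedModType R) (E : set X) (T : X -> X) :
    Prop :=
  (forall (a : R) (x y : X), E x -> E y -> T (a *: x + y) = a *: T x + T y) /\
  (exists M : R, forall x, E x -> `|T x| <= M * `|x|).

Definition almost_isometric_ideal (X : normedModType R) (Y : set X) : Prop :=
  [/\ closed Y, linear_subspace Y &
      forall E : set X, findim_subspace E ->
      forall eps : R, 0 < eps ->
      exists T : X -> X,
        [/\ bounded_linear_on E T,
            forall x, E x -> Y (T x),
            forall x, (E `&` Y) x -> T x = x &
            forall x, E x ->
              (1 + eps)^-1 * `|x| <= `|T x| <= (1 + eps) * `|x|]].

End subspaces.

Section operator_norm.
Variables (R : realType) (V W : normedModType R).

(* Meaningful only for bounded linear f: [sup] is 0 on unbounded sets. *)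
Definition opnorm (f : V -> W) : R :=
  sup [set `|f x| | x in [set x : V | `|x| <= 1]].

Variable f : V -> W.
Hypotheses (lf : linear f) (cf : continuous f).

Let lfun : {linear V -> W} := HB.pack f (GRing.isLinear.Build _ _ _ _ _ lf).

Lemma opnorm_has_sup : has_sup [set `|f x| | x in [set x : V | `|x| <= 1]].
Proof.
split; first by exists `|f 0|, 0 => //=; rewrite normr0.
have /linear_boundedP/pinfty_ex_gt0[r r0 fr] :=
  @continuous_linear_bounded _ _ _ 0 lfun (@cf 0).
exists r => _ [x /= x1 <-]; rewrite (le_trans (fr x))//.
by rewrite ler_piMr// ltW.
Qed.

Lemma opnorm_ge0 : 0 <= opnorm f.
Proof.
apply: (le_trans (normr_ge0 (f 0))).
by apply: (sup_upper_bound opnorm_has_sup); exists 0 => //=; rewrite normr0.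
Qed.

Lemma ler_opnorm x : `|f x| <= opnorm f * `|x|.
Proof.
have [->|x0] := eqVneq x 0.
  have f0 : f 0 = 0 := linear0 lfun.
  by rewrite f0 !normr0 mulr0.
rewrite -ler_pdivrMr ?normr_gt0//.
apply: (sup_upper_bound opnorm_has_sup).
have n0 : `|x| != 0 by rewrite normr_eq0.
exists (`|x|^-1 *: x) => /=.
  by rewrite normrZ normfV normr_id mulVf.
have -> : f (`|x|^-1 *: x) = `|x|^-1 *: f x 
  by exact: (linearZ_LR lfun).
by rewrite normrZ normfV normr_id mulrC.
Qed.

Lemma opnorm_le M : (forall x, `|x| <= 1 -> `|f x| <= M) -> opnorm f <= M.
Proof.
move=> fM; apply: ge_sup; first exact: opnorm_has_sup.1.
by move=> _ [x x1 <-]; exact: fM.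
Qed.

End operator_norm.

Section dual_space.
Variables (R : realType) (X : normedModType R).

Definition continuous_functional : {pred X -> R^o} :=
  [pred f : X -> R^o | `[< linear f /\ continuous f >] ].

Lemma continuous_functional_submod : submod_closed continuous_functional.
Proof.
split.
  apply/asboolP; split; first by move=> a u v; rewrite scaler0 addr0.
  exact: cst_continuous.
move=> a f g /asboolP[lf cf] /asboolP[lg cg]; apply/asboolP; split.
  move=> b u v /=; rewrite !fctE /= lf lg !scalerDr !scalerA (mulrC a b).
  by rewrite addrACA.
move=> x; apply: cvgD; last exact: cg.
by apply: cvgZr; exact: cf.
Qed.

HB.instance Definition _ := GRing.isSubmodClosed.Build R (X -> R^o)
  continuous_functional
  continuous_functional_submod.

Record dual_space := DualSpace {
  dual_fun :> X -> R^o ;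
  _ : dual_fun \in continuous_functional }.

HB.instance Definition _ := [isSub for dual_fun].
HB.instance Definition _ := [Choice of dual_space by <:].
HB.instance Definition _ := [SubChoice_isSubLmodule of dual_space by <:].

Lemma dual_linear (f : dual_space) : linear f.
Proof. by have /asboolP[] := valP f. Qed.

Lemma dual_continuous (f : dual_space) : continuous f.
Proof. by have /asboolP[] := valP f. Qed.

Lemma dual_norm_ge0 (f : dual_space) : 0 <= opnorm f.
Proof. exact: (opnorm_ge0 (@dual_linear f) (@dual_continuous f)). Qed.

Lemma ler_dual_norm (f : dual_space) x : `|f x| <= opnorm f * `|x|.
Proof. exact: (ler_opnorm (@dual_linear f) (@dual_continuous f)). Qed.

Lemma dual_normD (f g : dual_space) :
  opnorm (f + g) <= opnorm f + opnorm g.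
Proof.
apply: opnorm_le; [exact: dual_linear|exact: dual_continuous|].
move=> x x1 /=; rewrite (le_trans (ler_normD _ _))// lerD//.
- rewrite (le_trans (ler_dual_norm f x))//.
  by rewrite ler_piMr// dual_norm_ge0.
- rewrite (le_trans (ler_dual_norm g x))//.
  by rewrite ler_piMr// dual_norm_ge0.
Qed.

Lemma dual_normZ (a : R) (f : dual_space) : opnorm (a *: f) = `|a| * opnorm f.
Proof.
have leZ b (g : dual_space) : opnorm (b *: g) <= `|b| * opnorm g.
  apply: opnorm_le; [exact: dual_linear|exact: dual_continuous|].
  move=> x x1 /=; rewrite [leLHS]normrM ler_wpM2l//.
  rewrite (le_trans (ler_dual_norm g x))//.
  by rewrite ler_piMr// dual_norm_ge0.
apply/le_anti; rewrite leZ/=.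
have [->|a0] := eqVneq a 0.
  by rewrite normr0 mul0r; exact: (dual_norm_ge0 (0 *: f)).
rewrite -ler_pdivlMl ?normr_gt0// -normfV.
by have := leZ a^-1 (a *: f); rewrite scalerA mulVf// scale1r.
Qed.

Lemma dual_norm0 (f : dual_space) : opnorm f = 0 -> f = 0.
Proof.
move=> f0; apply: val_inj; apply/funext => x /=.
apply/eqP; rewrite -normr_le0.
by have := ler_opnorm (@dual_linear f) (@dual_continuous f) x; rewrite f0 mul0r.
Qed.

HB.instance Definition _ := @Lmodule_isNormed.Build R dual_space
  (fun f => opnorm f) dual_normD dual_normZ dual_norm0.

Definition annihilator (V : set X) : set dual_space :=
  [set f | forall x, V x -> f x = 0].

End dual_space.

(* Linearity is part of the type of P. *)
Definition contractive_projection (R : realType) (V : normedModType R)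
    (P : {linear V -> V}) : Prop :=
  [/\ continuous P, P \o P = P & opnorm P <= 1].

(* Main.v *)
(* Call A, a subset of X x X*, an approximate ideal if finitely many vectors of X
   can be moved into the first projection of A by a map which, up to epsilon, is
   additive, preserves norms, fixes given points of the first projection and
   preserves the values of given functionals of the second one. The family
   consists of the closed rectangular subspaces that are approximate ideals.
   Tuples of X fall into countably many types relative to finitely many points
   of X x X*, so closing a set under countably many Skolem functions makes it an
   approximate ideal and does not raise its density beyond omega; the property
   passes to closures and to directed unions. The limit P f of f o T along an
   ultrafilter of approximating maps T defines the projection of the dual space,
   since f o T depends only on the restriction of f to the first projection. *)

Require Import Defs.
From HB Require Import structures.
From mathcomp Require Import all_boot all_order all_algebra.
From mathcomp Require Import all_classical all_reals all_analysis.
From mathcomp Require Import ring lra.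

Set Implicit Arguments.
Unset Strict Implicit.
Unset Printing Implicit Defensive.

Import Order.TTheory GRing.Theory Num.Theory.
Import numFieldNormedType.Exports.

Local Open Scope classical_set_scope.
Local Open Scope ring_scope.
Local Open Scope card_scope.

(** * Comparison of cardinalities *)

Lemma card_le_fun T U (A : set T) (B : set U) (f : T -> U) :
  (forall x, A x -> B (f x)) ->
  (forall x y, A x -> A y -> f x = f y -> x = y) -> A #<= B.
Proof.
move=> fB fI.
have : $|{injfun A >-> B}|.
  apply/injfunPex; exists f => //.
  by move=> x y /set_mem Ax /set_mem Ay; exact: fI.
by case=> g; exact: inj_card_le.
Qed.

Lemma card_le_inj T (A : set T) U (B : set U) (u : U) : A #<= B ->
  exists f : T -> U, (forall x, A x -> B (f x)) /\
    (forall x y, A x -> A y -> f x = f y -> x = y).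
Proof.
pose V : pointedType := HB.pack U (gen_eqMixin U) (gen_choiceMixin U) (isPointed.Build U u).
move=> /(@pcard_leP T V)[f]; exists f; split; first by move=> x; exact: funS.
by move=> x y Ax Ay; apply: inj; rewrite inE.
Qed.

(** Disjoint copies of both sets in [T + U] form a two-element family, whose member of least
    cardinality is given by [ex_least_card]. *)
Lemma card_le_total T U (A : set T) (B : set U) : A #<= B \/ B #<= A.
Proof.
pose A' : set (T + U) := inl @` A; pose B' : set (T + U) := inr @` B.
have AA' : A #= A' by rewrite card_eq_sym; apply: inj_card_eq => x y _ _ [].
have BB' : B #= B' by rewrite card_eq_sym; apply: inj_card_eq => x y _ _ [].
have [|D [[->|->] leD]] := @ex_least_card _ [set A'; B'].
- by exists A'; left.
- left; rewrite (card_le_eql AA') (card_le_eqr BB'); apply: leD; right => //.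
- right; rewrite (card_le_eql BB') (card_le_eqr AA'); apply: leD; left => //.
Qed.

(** * Coding pairs and finite sequences in an infinite type *)

Section pairing.
Variables (K : Type) (i0 : nat -> K).
Hypothesis i0I : injective i0.

Let pdom (G : set (K * K * K)) : set K := [set x | exists y z, G (x, y, z)].

(* [G] is the graph of an injection of [pdom G * pdom G] into [pdom G]. *)
Let pairing_graph (G : set (K * K * K)) : Prop :=
  [/\ forall x y, pdom G x -> pdom G y -> exists z, G (x, y, z),
      forall x y x' y' z, G (x, y, z) -> G (x', y', z) -> x = x' /\ y = y' &
      forall x y z, G (x, y, z) -> [/\ pdom G x, pdom G y & pdom G z]].

(** The pairing of natural numbers, carried to the range of [i0]. Joining it to every graph keeps
    the domains infinite and takes care of the empty chain. *)
Let G0 : set (K * K * K) :=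
  [set (i0 p.1, i0 p.2, i0 (pickle p)) | p in [set: nat * nat]].

Let pdom_G0 n : pdom G0 (i0 n).
Proof. by exists (i0 n), (i0 (pickle (n, n))), (n, n). Qed.

Let pairing_G0 : pairing_graph G0.
Proof.
split.
- move=> _ _ [_ [_ [[n ?] _ [<- _ _]]]] [_ [_ [[m ?] _ [<- _ _]]]].
  by exists (i0 (pickle (n, m))), (n, m).
- move=> x y x' y' z [[a b] _ [<- <- <-]] [[c d] _ [<- <- /i0I]] /= e.
  by have [-> ->] := pcan_inj pickleK e.
- by move=> x y z [[a b] _ [<- <- <-]]; split.
Qed.

(** Each clause involves at most two triples, and these already lie in a single pairing graph below
    the union. *)
Let pairing_chain (F : set (set (K * K * K))) :
  (forall G, F G -> pairing_graph (G0 `|` G)) -> total_on F subset ->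
  pairing_graph (G0 `|` \bigcup_(G in F) G).
Proof.
move=> FP Ftot; set U := _ `|` _.
have sub G : F G -> G0 `|` G `<=` U.
  by move=> FG; apply: setUS => t Gt; exists G.
have join t t' : U t -> U t' ->
    exists G, [/\ pairing_graph G, G `<=` U, G t & G t'].
  move=> [t0|[G FG Gt]] [t0'|[G' FG' Gt']].
  - by exists G0; split => //; left.
  - by exists (G0 `|` G'); split; [exact: FP|exact: sub|left|right].
  - by exists (G0 `|` G); split; [exact: FP|exact: sub|right|left].
  - have [GG'|G'G] := Ftot _ _ FG FG'.
    + by exists (G0 `|` G'); split; [exact: FP|exact: sub|right; exact: GG'|right].
    + by exists (G0 `|` G); split; [exact: FP|exact: sub|right|right; exact: G'G].
have domS G x : G `<=` U -> pdom G x -> pdom U x.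
  by move=> GU [y [z Gz]]; exists y, z; exact: GU.
split.
- move=> x y [x' [x'' Ux]] [y' [y'' Uy]].
  have [G [[G1 G2 G3] GU Gx Gy]] := join _ _ Ux Uy.
  have [||z Gz] := G1 x y; last by exists z; exact: GU.
  + by exists x', x''.
  + by exists y', y''.
- move=> x y x' y' z Ux Uy.
  have [G [[G1 G2 G3] GU Gx Gy]] := join _ _ Ux Uy.
  exact: G2 Gx Gy.
- move=> x y z Ux.
  have [G [[G1 G2 G3] GU Gx _]] := join _ _ Ux Ux.
  by have [? ? ?] := G3 _ _ _ Gx; split; apply: domS GU _.
Qed.

(** An infinite cardinal equals its square. Let [A] be the domain of a maximal graph. If the
    complement of [A] embeds in [A], so does [K], and the pairing of [A] pulls back; otherwise [A]
    has a copy outside itself and the graph extends to the union of both, against maximality. *)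
Lemma ex_pairing : exists p : K * K -> K, injective p.
Proof.
have [G [PG maxG]] := Zorn_bigcup pairing_chain.
have [{}PG GG] : pairing_graph (G0 `|` G) /\ G `<=` G0 `|` G.
  by split=> // t; right.
set H := G0 `|` G in PG GG.
have [H1 H2 H3] := PG.
pose A := pdom H.
have Ai n : A (i0 n).
  by have [y [z h]] := pdom_G0 n; exists y, z; left.
have /choice[f fP] : forall q : K * K, exists z,
    A q.1 -> A q.2 -> H (q.1, q.2, z).
  move=> [x y] /=; have [Ax|nAx] := pselect (A x); last by exists x.
  have [Ay|nAy] := pselect (A y); last by exists x.
  by have [z Hz] := H1 _ _ Ax Ay; exists z.
have fA x y : A x -> A y -> A (f (x, y)).
  by move=> Ax Ay; have [] := H3 _ _ _ (fP (x, y) Ax Ay).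
have fI x y x' y' : A x -> A y -> A x' -> A y' -> f (x, y) = f (x', y') ->
    x = x' /\ y = y'.
  move=> Ax Ay Ax' Ay' e; have := fP (x', y') Ax' Ay'.
  by rewrite /= -e; apply: H2; exact: (fP (x, y)).
have i01 : i0 0 <> i0 1 by move=> /i0I.
have [/(card_le_inj (i0 0))[g [gA gI]]|/(card_le_inj (i0 0))[b [bA bI]]] :=
  card_le_total (~` A) A.
  pose h x := if `[< A x >] then f (i0 0, x) else f (i0 1, g x).
  have hA x : A (h x).
    by rewrite /h; case: asboolP => Ax; apply: fA => //; exact: gA.
  have hI : injective h.
    move=> x y; rewrite /h; case: asboolP => Ax; case: asboolP => Ay e.
    - by have [] := fI _ _ _ _ (Ai _) Ax (Ai _) Ay e.
    - by have [] := fI _ _ _ _ (Ai _) Ax (Ai _) (gA _ Ay) e.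
    - by have [/esym] := fI _ _ _ _ (Ai _) (gA _ Ax) (Ai _) Ay e.
    - have [_] := fI _ _ _ _ (Ai _) (gA _ Ax) (Ai _) (gA _ Ay) e; exact: gI.
  exists (fun q => f (h q.1, h q.2)) => -[x y] [x' y'] /= e.
  by have [/hI -> /hI ->] := fI _ _ _ _ (hA _) (hA _) (hA _) (hA _) e.
exfalso.
(* [E false] is the inclusion of [A], [E true] its copy under [b], disjoint from [A]. *)
pose E (s : bool) x := if s then b x else x.
pose tg (s : bool) := i0 s.
have EI s x t y : A x -> A y -> E s x = E t y -> s = t /\ x = y.
  move=> Ax Ay; case: s t => -[] /= e //.
  - by split=> //; exact: bI.
  - by case: (bA _ Ax); rewrite /= e.
  - by case: (bA _ Ay); rewrite /= -e.
have tgA s : A (tg s) by exact: Ai.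
(* Codes in [A] a pair together with its two Boolean tags. The triples of [N] apply [b] to this
   code, so their values avoid those of [H], which lie in [A]. *)
pose w s t x y := f (f (tg s, tg t), f (x, y)).
have wA s t x y : A x -> A y -> A (w s t x y).
  by move=> Ax Ay; apply: (fA) => //; apply: fA.
have wI s t x y s' t' x' y' : A x -> A y -> A x' -> A y' ->
    w s t x y = w s' t' x' y' -> [/\ s = s', t = t', x = x' & y = y'].
  move=> Ax Ay Ax' Ay' e.
  have [e1 e2] := fI _ _ _ _ (fA _ _ (tgA s) (tgA t)) (fA _ _ Ax Ay)
    (fA _ _ (tgA s') (tgA t')) (fA _ _ Ax' Ay') e.
  have [/i0I ss' /i0I tt'] := fI _ _ _ _ (tgA _) (tgA _) (tgA _) (tgA _) e1.
  have [-> ->] := fI _ _ _ _ Ax Ay Ax' Ay' e2.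
  by split => //; [case: s s' ss' {e e1} => -[]|case: t t' tt' {e e1} => -[]].
pose N : set (K * K * K) := [set u | exists s t x y,
  [/\ s || t, A x, A y & u = (E s x, E t y, b (w s t x y))]].
have N3 x y z : N (x, y, z) -> exists s t x' y',
    [/\ s || t, A x', A y' & [/\ x = E s x', y = E t y' & z = b (w s t x' y')]].
  by move=> [s [t [x' [y' [st Ax Ay [-> -> ->]]]]]]; exists s, t, x', y'; split.
have domE s x : A x -> pdom (H `|` N) (E s x).
  move=> Ax; case: s => /=.
    exists (b x), (b (w true true x x)); right.
    by exists true, true, x, x; split.
  by case: Ax => y [z Hz]; exists y, z; left.
have domN x : pdom (H `|` N) x -> exists s x', A x' /\ x = E s x'.
  move=> [y [z [Hz|/N3[s [t [x' [y' [_ Ax Ay [-> _ _]]]]]]]]]; last by exists s, x'.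
  by exists false, x; split => //; exists y, z.
have PN : pairing_graph (H `|` N).
  split.
  - move=> _ _ /domN[s [x [Ax ->]]] /domN[t [y [Ay ->]]].
    case: (boolP (s || t)) => st.
      by exists (b (w s t x y)); right; exists s, t, x, y; split.
    case: s t st => -[]//= _; have [z Hz] := H1 _ _ Ax Ay.
    by exists z; left.
  - move=> x y x' y' z [Hz|Nz] [Hz'|Nz'].
    + exact: H2 Hz Hz'.
    + have [_ _ Az] := H3 _ _ _ Hz.
      have [s [t [u [v [_ Au Av [_ _ e]]]]]] := N3 _ _ _ Nz'.
      by case: (bA _ (wA s t _ _ Au Av)); rewrite /= -e.
    + have [_ _ Az] := H3 _ _ _ Hz'.
      have [s [t [u [v [_ Au Av [_ _ e]]]]]] := N3 _ _ _ Nz.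
      by case: (bA _ (wA s t _ _ Au Av)); rewrite /= -e.
    + have [s [t [u [v [_ Au Av [-> -> ez]]]]]] := N3 _ _ _ Nz.
      have [s' [t' [u' [v' [_ Au' Av' [-> -> e]]]]]] := N3 _ _ _ Nz'.
      rewrite ez in e.
      have := bI _ _ (wA s t _ _ Au Av) (wA s' t' _ _ Au' Av') e.
      by move=> /(wI _ _ _ _ _ _ _ _ Au Av Au' Av')[-> -> -> ->].
  - move=> x y z [Hz|Nz].
      by have [? ? ?] := H3 _ _ _ Hz; split; exact: (domE false).
    have [s [t [u [v [_ Au Av [-> -> ->]]]]]] := N3 _ _ _ Nz.
    by split; [exact: domE|exact: domE|exact/(domE true)/wA].
apply: (maxG (G `|` N)); last by rewrite setUA.
split; first by move=> t; left.
pose c := i0 0.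
have Nc : N (b c, b c, b (w true true c c)) by exists true, true, c, c; split => //; exact: Ai.
move=> /(_ _ (or_intror Nc)) Gc.
by have [+ _ _] := H3 _ _ _ (GG _ Gc); apply: (bA c) (Ai 0%N).
Qed.

(** The length is stored in front because [i0 0], the code of the empty list, may also be the code
    of a pair. *)
Lemma ex_seq_code : exists c : seq K -> K, injective c.
Proof.
have [p pI] := ex_pairing.
pose enc := foldr (fun x k => p (x, k)) (i0 0).
exists (fun s => p (i0 (size s), enc s)) => s t /pI[/i0I].
elim: s t => [|x s IH] [|y t] //= [st] /pI[-> /(IH _ st) -> //].
Qed.

End pairing.

(* The closure of [D] under [G] consists of the values of finite trees with
   leaves in [D]. *)
Lemma ex_closed_under (Z : choiceType) (K : Type) (i0 : nat -> K)
    (G : seq Z -> nat -> Z) (D : set Z) (iD : Z -> K) : injective i0 ->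
  (forall x y, D x -> D y -> iD x = iD y -> x = y) ->
  exists H : set Z, [/\ D `<=` H,
    forall s n, (forall z, z \in s -> H z) -> H (G s n) & H #<= [set: K]].
Proof.
move=> i0I iDI.
pose ev := fix ev (t : GenTree.tree Z) : Z :=
  match t with
  | GenTree.Leaf z => z
  | GenTree.Node n ts => G (map ev ts) n
  end.
pose L := fix L (t : GenTree.tree Z) : Prop :=
  match t with
  | GenTree.Leaf z => D z
  | GenTree.Node n ts => foldr (fun t P => L t /\ P) True ts
  end.
exists [set ev t | t in L]; split.
- by move=> z Dz; exists (GenTree.Leaf z).
- move=> s n sH.
  suff [ts [Lts <-]] : exists ts, foldr (fun t P => L t /\ P) True ts /\
      map ev ts = s by exists (GenTree.Node n ts).
  elim: s sH => [|z s IH] sH; first by exists nil.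
  have [|ts [Lts <-]] := IH.
    by move=> y ys; apply: sH; rewrite in_cons ys orbT.
  have [t Lt <-] := sH z (mem_head _ _).
  by exists (t :: ts).
- have [c cI] := ex_seq_code i0I.
  have [p pI] := ex_pairing i0I.
  apply: card_le_trans (card_image_le _ _) _.
  (* A tree is determined by its flat encoding, whose letters are natural numbers or leaves. The
     tags [i0 0] and [i0 1] separate the two kinds; [okl] is there since [iD] is injective only on
     [D]. *)
  pose lf (u : nat + Z) := match u with
    | inl n => p (i0 0%N, i0 n) | inr z => p (i0 1%N, iD z) end.
  pose okl (u : nat + Z) := if u is inr z then D z else True.
  have lfI u v : okl u -> okl v -> lf u = lf v -> u = v.
    case: u v => [n|z] [m|y] //= => [_ _|_ _|_ _|Dz Dy] /pI[].
    + by move=> /i0I ->.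
    + by move/i0I.
    + by move/i0I.
    + by move=> /(iDI _ _ Dz Dy) ->.
  have okE : forall t, L t -> forall u, u \in GenTree.encode t -> okl u.
    fix IHt 1; case=> [z|n ts] /=.
      by move=> Dz u; rewrite inE => /eqP ->.
    move=> Lts u; rewrite inE => /orP[/eqP -> //|].
    rewrite mem_rcons inE => /orP[/eqP -> //|].
    move=> /flattenP[r /mapP[t tts ->]] ur.
    elim: ts Lts tts => //= t' ts IH [Lt' Lts].
    rewrite inE => tts.
    case: (eqVneq t t') tts => [tt' _|_ /= tts]; last exact: IH.
    by rewrite tt' in ur; exact: (IHt t' Lt').
  have mapI (s1 s2 : seq (nat + Z)) :
      (forall u, u \in s1 -> okl u) -> (forall u, u \in s2 -> okl u) ->
      map lf s1 = map lf s2 -> s1 = s2.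
    elim: s1 s2 => [|u s1 IH] [|v s2] //= o1 o2 [e1 e2].
    have -> : u = v.
      by apply: lfI e1; [apply: o1|apply: o2]; rewrite mem_head.
    congr cons; apply: IH e2 => x xs.
    + by apply: o1; rewrite in_cons xs orbT.
    + by apply: o2; rewrite in_cons xs orbT.
  apply: (@card_le_fun _ _ _ _ (fun t => c (map lf (GenTree.encode t)))) => //.
  move=> t1 t2 Lt1 Lt2 /cI /mapI e.
  by apply: (pcan_inj (@GenTree.codeK Z)); apply: e; exact: okE.
Qed.

(** * Density of subsets of a normed space *)

Lemma closure_normP (R : realType) (Z : normedModType R) (A : set Z) (x : Z) :
  closure A x <-> forall e : R, 0 < e -> exists2 y, A y & `|x - y| < e.
Proof.
split=> [clA e e0|H B].
  have [y [Ay yB]] := clA _ (nbhsx_ballx x e e0).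
  by exists y => //; move: yB; rewrite -ball_normE.
rewrite -nbhs_ballE => -[e /= e0 eB]; have [y Ay xy] := H e e0.
by exists y; split => //; apply: eB; rewrite -ball_normE.
Qed.

Lemma cardinal_max_omegaP (a : cardinal) (m := card_set (cardinal_max a omega)) :
  [/\ [set: nat] #<= m, card_set a #<= m &
    forall T (B : set T), [set: nat] #<= B -> card_set a #<= B -> m #<= B].
Proof.
rewrite /m /cardinal_max; case: ifPn => /= aw.
  by split => //; exact: card_lexx.
have [aw'|wa] := card_le_total (card_set a) [set: nat]; last by split => //; exact: card_lexx.
by rewrite aw' in aw.
Qed.

Lemma dens_closure (R : realType) (Z : normedModType R) (Y : set Z) :
  Y `<=` closure ((fun y : set_type Y => \val y) @` card_set (dens (set_type Y))).
Proof.
move=> y Yy B; rewrite nbhsE; case=> O [oO Oy] OB.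
have [dY _] := dens_least (set_type Y).
have [||[z Yz] [Oz Dz]] := dY ((fun y : set_type Y => \val y) @^-1` O).
- by exists (SigSub (mem_set Yy)).
- by exists O.
- by exists z; split; [exists (SigSub Yz)|exact: OB].
Qed.

(** [D] may lie outside [Y]: for each [d] in [D] and each [n], a point of [Y] within [1 / (n + 1)]
    of [d] is chosen when there is one. These points are dense in [Y] and indexed by pairs, which
    [ex_pairing] helps to embed in [K]. *)
Lemma dens_le (R : realType) (Z : normedModType R) (Y D : set Z) (K : Type)
    (i0 : nat -> K) : injective i0 -> D #<= [set: K] -> Y `<=` closure D ->
  card_set (dens (set_type Y)) #<= [set: K].
Proof.
move=> i0I DK YD.
have [_ minD] := dens_least (set_type Y).
pose near (q : Z * nat) (y : set_type Y) := `|\val y - q.1| < q.2.+1%:R^-1 :> R.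
have /choice[g gP] : forall q : Z * nat, exists o : option (set_type Y),
    forall y, near q y -> exists2 z, o = Some z & near q z.
  move=> q; have [[z nz]|no] := pselect (exists y, near q y).
    by exists (Some z) => y _; exists z.
  by exists None => y ny; case: no; exists y.
pose E := [set y | exists q, D q.1 /\ g q = Some y].
have dE : dense E.
  move=> O [y Oy] [B oB BO].
  have By : B (\val y) by move: Oy; rewrite -BO.
  have /nbhs_ballP[e /= e0 eB] : nbhs (\val y) B by apply: open_nbhs_nbhs.
  pose n := Num.truncn (2 / e).
  have ne : n.+1%:R^-1 < e / 2.
    by rewrite invf_plt ?posrE ?divr_gt0// invf_div; exact: truncnS_gt.
  have [|d Dd yd] := (closure_normP _ _).1 (YD _ (set_valP y)) n.+1%:R^-1.
    by rewrite invr_gt0.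
  have [|z gz zd] := gP (d, n) y; first exact: yd.
  exists z; split; last by exists (d, n).
  rewrite -BO; apply: eB; rewrite -ball_normE /ball_ /=.
  have -> : \val y - \val z = (\val y - d) - (\val z - d).
    by rewrite opprB addrA subrK.
  apply: le_lt_trans (ler_normB _ _) _; rewrite (splitr e) ltrD//.
  - exact: lt_trans yd ne.
  - exact: lt_trans zd ne.
apply: card_le_trans (minD _ dE) _.
have [c [_ cI]] := card_le_inj (i0 0) DK.
have [p pI] := ex_pairing i0I.
have /choice[q qP] : forall y, exists q, E y -> D q.1 /\ g q = Some y.
  move=> y; have [[q Eq]|nE] := pselect (E y); first by exists q.
  by exists (\val y, 0%N).
apply: (@card_le_fun _ _ _ _ (fun y => p (c (q y).1, i0 (q y).2))) => //.
move=> y z Ey Ez /pI[]; have [Dy gy] := qP _ Ey; have [Dz gz] := qP _ Ez.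
move=> /(cI _ _ Dy Dz) e1 /i0I e2.
by move: gy gz; rewrite [q y]surjective_pairing e1 e2 -surjective_pairing => -> [].
Qed.

(** Closing a least dense subset of [Y] under [G] stays within the cardinality of the maximum for
    [Y]. Conversely, a dense subset of [closure H] has [Y] in its closure, so [dens_le] bounds the
    density of [Y] by the maximum for [closure H]. *)
Lemma ex_dens_closed_under (R : realType) (Z : normedModType R)
    (G : seq Z -> nat -> Z) (Y : set Z) :
  exists H : set Z, [/\ forall s n, (forall z, z \in s -> H z) -> H (G s n),
    Y `<=` closure H &
    cardinal_eq (cardinal_max (dens (set_type Y)) omega)
                (cardinal_max (dens (set_type (closure H))) omega)].
Proof.
have [wm Ym minm] := cardinal_max_omegaP (dens (set_type Y)).
set m := cardinal_max (dens (set_type Y)) omega in wm Ym minm *.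
have [m0 mm0] : card_set m !=set0.
  apply/set0P/negP => /eqP m0; move: wm; rewrite m0 card_le0 => /eqP/seteqP[+ _].
  by move=> /(_ 0%N); apply.
pose K := set_type (card_set m).
have mK : card_set m #= [set: K] by exact: card_setT_sym.
have [||i0 [_ i0I']] := @card_le_inj _ [set: nat] K [set: K].
- exact: SigSub (mem_set mm0).
- by rewrite -(card_le_eqr mK).
have i0I : injective i0 by move=> x y; exact: i0I'.
pose D := (fun y : set_type Y => \val y) @` card_set (dens (set_type Y)).
have DK : D #<= [set: K].
  apply: card_le_trans (card_image_le _ _) _.
  by rewrite -(card_le_eqr mK).
have [iD [_ iDI]] := card_le_inj (i0 0) DK.
have [H [DH HG HK]] := ex_closed_under G i0I iDI.
have YH : Y `<=` closure H.
  exact: subset_trans (@dens_closure R Z Y) (closureS DH).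
exists H; split => //.
have [wm' Ym' minm'] := cardinal_max_omegaP (dens (set_type (closure H))).
set m' := cardinal_max _ _ in wm' Ym' minm' *.
apply/card_eqPle; split; last first.
  apply: minm' => //; rewrite (card_le_eqr mK).
  exact: (dens_le i0I HK).
apply: minm => //.
have [m0' mm0'] : card_set m' !=set0.
  apply/set0P/negP => /eqP m'0; move: wm'; rewrite m'0 card_le0 => /eqP/seteqP[+ _].
  by move=> /(_ 0%N); apply.
pose K' := set_type (card_set m').
have mK' : card_set m' #= [set: K'] by exact: card_setT_sym.
have [||j0 [_ j0I']] := @card_le_inj _ [set: nat] K' [set: K'].
- exact: SigSub (mem_set mm0').
- by rewrite -(card_le_eqr mK').
have j0I : injective j0 by move=> x y; exact: j0I'.
rewrite (card_le_eqr mK').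
apply: (dens_le j0I _ (subset_trans YH (@dens_closure R Z (closure H)))).
apply: card_le_trans (card_image_le _ _) _.
by rewrite -(card_le_eqr mK').
Qed.

(** * Approximate ideals and their limits *)

Section approximate_retractions.
Variables (R : realType) (X : normedModType R).
Implicit Types (A B H : set (X * dual_space X)) (s : seq (X * dual_space X)).

Lemma dual_subE (f g : dual_space X) (x : X) : (f - g) x = f x - g x.
Proof. by []. Qed.

Lemma ler_dual (f : dual_space X) (x : X) : `|f x| <= `|f| * `|x|.
Proof. exact: ler_dual_norm. Qed.

Lemma prod_norm_fst (V W : normedModType R) (z : V * W) : `|z.1| <= `|z|.
Proof. by rewrite prod_normE le_max lexx. Qed.

Lemma prod_norm_snd (V W : normedModType R) (z : V * W) : `|z.2| <= `|z|.
Proof. by rewrite prod_normE le_max lexx orbT. Qed.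

(* Scalar multiples are not tested: additivity and norm preservation give them in
   the limit, see [limit_retractionZ]. *)
Definition approx_retraction A s (E : seq X) (eps : R) (T : X -> X) : Prop :=
  [/\ forall x, (fst @` A) (T x),
      forall z, z \in s -> `|T z.1 - z.1| <= eps,
      forall z x, z \in s -> x \in E -> `|z.2 (T x) - z.2 x| <= eps,
      forall x, x \in E -> `| `|T x| - `|x| | <= eps &
      forall x y, x \in E -> y \in E -> `|T (x + y) - (T x + T y)| <= eps].

Definition approx_ideal A : Prop := forall s (E : seq X) (eps : R), 0 < eps ->
  (forall z, z \in s -> A z) -> exists T, approx_retraction A s E eps T.

(** [B] may vary with [s] and [d], which covers closures and directed unions at once. A map that is
    good for points of [B] near [s] is good for [s]: changing a functional by [d] costs at most [d]
    times the norms of [x] and [T x]. *)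
Lemma approx_ideal_limit A :
  (forall s (d : R), 0 < d -> (forall z, z \in s -> A z) ->
    exists B, [/\ B `<=` A, approx_ideal B &
      forall z, z \in s -> exists2 y, B y & `|z - y| < d]) ->
  approx_ideal A.
Proof.
move=> AB s E eps eps0 sA.
pose M := \sum_(x <- E) `|x|.
have M0 : 0 <= M by apply: sumr_ge0.
have EM x : x \in E -> `|x| <= M.
  by move=> xE; rewrite /M (big_rem x xE)/= lerDl sumr_ge0.
(* Functional values will err by at most [d * (2 * M + 2)] and fixed points by [5 * d]; [d <= 1]
   keeps the norm of [T x] below [M + 1]. *)
pose d := Num.min 1 (eps / (2 * M + 5)).
have d0 : 0 < d by rewrite lt_min ltr01 divr_gt0//; lra.
have d1 : d <= 1 by rewrite ge_min lexx.
have deps : d * (2 * M + 5) <= eps.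
  by rewrite -ler_pdivlMr ?ge_min ?lexx ?orbT//; lra.
have [B [BA Bid sB]] := AB s d d0 sA.
have /choice[a aP] : forall z, exists y, z \in s -> B y /\ `|z - y| < d.
  move=> z; have [zs|zs] := boolP (z \in s); last by exists z.
  by have [y] := sB z zs; exists y.
(* Testing [a z] and [z - a z] makes [T z] close to [z]. *)
have [|T [TB Ta Tf Tn TD]] := Bid (map a s)
    (E ++ flatten [seq [:: (a z).1; z.1 - (a z).1] | z <- s]) d d0.
  by move=> _ /mapP[z zs ->]; have [] := aP z zs.
have inE1 x : x \in E -> x \in
    E ++ flatten [seq [:: (a z).1; z.1 - (a z).1] | z <- s].
  by move=> xE; rewrite mem_cat xE.
have inE2 z x : z \in s -> x \in [:: (a z).1; z.1 - (a z).1] -> x \in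
    E ++ flatten [seq [:: (a z).1; z.1 - (a z).1] | z <- s].
  move=> zs xz; rewrite mem_cat; apply/orP; right; apply/flattenP.
  by exists [:: (a z).1; z.1 - (a z).1] => //; apply/mapP; exists z.
have Md : 0 <= d * M by rewrite mulr_ge0// ltW.
have d5 : 5 * d <= eps by lra.
exists T; split.
- by move=> x; have [y By <-] := TB x; exists y => //; exact: BA.
- move=> z zs; have [_ zd] := aP z zs.
  have zd1 := le_lt_trans (prod_norm_fst _) zd.
  have e1 : (a z).1 \in [:: (a z).1; z.1 - (a z).1] by rewrite inE eqxx.
  have e2 : z.1 - (a z).1 \in [:: (a z).1; z.1 - (a z).1].
    by rewrite !inE eqxx orbT.
  have h1 := TD _ _ (inE2 _ _ zs e1) (inE2 _ _ zs e2).
  rewrite (addrC (a z).1) subrK in h1.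
  have h2 := Ta _ (map_f a zs).
  have h3 := Tn _ (inE2 _ _ zs e2).
  have -> : T z.1 - z.1 = (T z.1 - (T (a z).1 + T (z.1 - (a z).1)))
      + (T (a z).1 - (a z).1) + T (z.1 - (a z).1) - (z.1 - (a z).1).
    by rewrite [X in X - (_ - _)]addrAC (opprD (T _)) (addrA (T z.1)) subrK (addrA (T z.1 - _))
      subrK opprB addrA subrK.
  have n1 := ler_normD (T z.1 - (T (a z).1 + T (z.1 - (a z).1)))
     (T (a z).1 - (a z).1).
  have n2 := ler_normD (T z.1 - (T (a z).1 + T (z.1 - (a z).1))
     + (T (a z).1 - (a z).1)) (T (z.1 - (a z).1)).
  have n3 := ler_normB (T z.1 - (T (a z).1 + T (z.1 - (a z).1))
     + (T (a z).1 - (a z).1) + T (z.1 - (a z).1)) (z.1 - (a z).1).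
  move: h3; rewrite ler_norml => /andP[_ h3].
  have {}zd1 : `|z.1 - (a z).1| < d by exact: zd1.
  lra.
- move=> z x zs xE; have [_ zd] := aP z zs.
  have zd2 : `|z.2 - (a z).2| < d := le_lt_trans (prod_norm_snd _) zd.
  have h1 := Tf _ _ (map_f a zs) (inE1 _ xE).
  have := Tn _ (inE1 _ xE); rewrite ler_norml => /andP[_ h2].
  have -> : z.2 (T x) - z.2 x = (z.2 - (a z).2) (T x) - (z.2 - (a z).2) x
      + ((a z).2 (T x) - (a z).2 x).
    by rewrite !dual_subE; ring.
  apply: le_trans (ler_normD _ _) _.
  apply: le_trans (lerD (ler_normB _ _) h1) _.
  have n1 := ler_dual (z.2 - (a z).2) (T x).
  have n2 := ler_dual (z.2 - (a z).2) x.
  have m1 : `|z.2 - (a z).2| * `|T x| <= d * (M + 1).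
    by apply: ler_pM => //; [exact: ltW|have := EM _ xE; lra].
  have m2 : `|z.2 - (a z).2| * `|x| <= d * M.
    by apply: ler_pM => //; [exact: ltW|exact: EM].
  lra.
- by move=> x /inE1/Tn/le_trans; apply; lra.
- by move=> x y /inE1 xE /inE1 yE; apply: le_trans (TD _ _ xE yE) _; lra.
Qed.

(** The density of the rationals in the scalars gives linearity of the closure, so countably many
    operations can enforce it. *)
Lemma closure_linear (V : normedModType R) (A : set V) : A 0 ->
  (forall (q : rat) u v, A u -> A v -> A (ratr q *: u + v)) ->
  linear_subspace (closure A).
Proof.
move=> A0 Alin; split; first by rewrite inE; exact: subset_closure.
move=> a u v; rewrite !inE => uA vA; apply/closure_normP => e e0.
have u1 : 0 < `|u| + 1 by rewrite ltr_wpDl.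
(* [q] is fixed before [u'], since the tolerance for [u'] depends on the size of [q]. *)
have [q] : exists q, ratr q \in `]a - e / 3 / (`|u| + 1), a + e / 3 / (`|u| + 1)[.
  by apply: rat_in_itvoo; rewrite ltrD2l gtrN// !divr_gt0.
rewrite in_itv/= => /andP[q1 q2].
have q3 : 0 < `|ratr q : R| + 1 by rewrite ltr_wpDl.
have [|u' Au' uu'] := (closure_normP _ _).1 uA (e / 3 / (`|ratr q| + 1)).
  by rewrite !divr_gt0.
have [|v' Av' vv'] := (closure_normP _ _).1 vA (e / 3); first by rewrite !divr_gt0.
exists (ratr q *: u' + v'); first exact: Alin.
have -> : a *: u + v - (ratr q *: u' + v') =
    (a - ratr q) *: u + ratr q *: (u - u') + (v - v').
  by rewrite scalerBl scalerBr (addrA (_ *: u - _)) subrK opprD addrACA.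
have h1 : `|(a - ratr q) *: u| <= e / 3.
  rewrite normrZ; apply: (@le_trans _ _ (e / 3 / (`|u| + 1) * (`|u| + 1))).
    by apply: ler_pM => //; [rewrite ler_norml; lra|lra].
  by rewrite divfK// gt_eqF.
have h2 : `|ratr q *: (u - u')| <= e / 3.
  rewrite normrZ mulrC.
  apply: (@le_trans _ _ (e / 3 / (`|ratr q| + 1) * (`|ratr q| + 1))).
    by apply: ler_pM => //; [exact: ltW|lra].
  by rewrite divfK// gt_eqF.
have n1 := ler_normD ((a - ratr q) *: u) (ratr q *: (u - u')).
have n2 := ler_normD ((a - ratr q) *: u + ratr q *: (u - u')) (v - v').
lra.
Qed.

End approximate_retractions.

(** * The family and its richness *)

Section rich_family.
Variables (R : realType) (X : normedModType R).
Implicit Types (A B H : set (X * dual_space X)) (s : seq (X * dual_space X)).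

Lemma closed_rect A : (forall z z', A z -> A z' -> A (z.1, z'.2)) ->
  forall z z', closure A z -> closure A z' -> closure A (z.1, z'.2).
Proof.
move=> rA z z' zA z'A; apply/closure_normP => e e0.
have [y Ay zy] := (closure_normP _ _).1 zA e e0.
have [y' Ay' zy'] := (closure_normP _ _).1 z'A e e0.
exists (y.1, y'.2); first exact: rA.
rewrite prod_normE gt_max/= (le_lt_trans _ zy) ?(le_lt_trans _ zy')//.
- exact: (prod_norm_snd (z' - y')).
- exact: (prod_norm_fst (z - y)).
Qed.

Lemma floor_eq_dist (a b : R) (n : nat) :
  Num.floor (a * n.+1%:R) = Num.floor (b * n.+1%:R) -> `|a - b| <= n.+1%:R^-1.
Proof.
move=> e; rewrite -[leRHS]mul1r ler_pdivlMr//.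
rewrite -[X in _ * X]normr_nat -normrM mulrBl.
have := Num.Theory.floor_itv (a * n.+1%:R).
have := Num.Theory.floor_itv (b * n.+1%:R).
by rewrite e intrD ler_norml => /andP[? ?] /andP[? ?]; lra.
Qed.

Let key : Type := (nat * nat * seq (int * seq (bool * int) * seq (seq bool)))%type.

(* Two tuples with the same key satisfy the same additive relations, coincide
   with the same points of [s], and have the same norms and the same values
   under the functionals of [s] up to [1 / (n + 1)]. *)
Let tuple_key (n : nat) s (e : seq X) : key :=
  (n, size e, mkseq (fun i =>
    (Num.floor (`|e`_i| * n.+1%:R),
     [seq (z.1 == e`_i, Num.floor (z.2 e`_i * n.+1%:R)) | z : X * dual_space X <- s],
     mkseq (fun j => mkseq (fun k => e`_i + e`_j == e`_k) (size e)) (size e)))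
    (size e)).

Let mkseq_inj T (f g : nat -> T) (m i : nat) :
  mkseq f m = mkseq g m -> (i < m)%N -> f i = g i.
Proof.
by move=> e im; have := congr1 (fun t => nth (f i) t i) e; rewrite !nth_mkseq.
Qed.

(** For each realized key one tuple is chosen, depending on [s] and the key but not on the tuple
    that realizes it. *)
Let skolem_ex : exists sk : seq (X * dual_space X) -> key -> seq X,
  forall s n e, tuple_key n s (sk s (tuple_key n s e)) = tuple_key n s e.
Proof.
have /choice[sk skP] : forall u : seq (X * dual_space X) * key,
    exists e', forall n e, tuple_key n u.1 e = u.2 -> tuple_key n u.1 e' = u.2.
  move=> [s k]; have [[n [e ek]]|no] := pselect (exists n e, tuple_key n s e = k).
    exists e => m e'' /= e''k; suff -> : m = n by [].
    by move: ek; rewrite -e''k => -[].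
  by exists nil => n e /= ek; case: no; exists n, e.
by exists (fun s k => sk (s, k)) => s n e; apply: skP.
Qed.

(** The index codes countably many operations: rational combinations, mixing of components, and
    entries of the Skolem tuples. Any tuple of test vectors has a twin with the same key in the
    first projection of [H]; [T] maps entry to entry. *)
Lemma ex_ideal_operations : exists G : seq (X * dual_space X) -> nat -> X * dual_space X,
  forall H, (forall s n, (forall z, z \in s -> H z) -> H (G s n)) ->
  [/\ H 0, forall (q : rat) u v, H u -> H v -> H (ratr q *: u + v),
    forall z z', H z -> H z' -> H (z.1, z'.2) & approx_ideal H].
Proof.
have [sk skP] := skolem_ex.
pose G s (n : nat) : X * dual_space X :=
  match unpickle n : option (option rat + (key * nat)) with
  | Some (inl None) => ((s`_0).1, (s`_1).2)
  | Some (inl (Some q)) => ratr q *: s`_0 + s`_1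
  | Some (inr (k, i)) => ((sk s k)`_i, 0)
  | None => 0
  end.
exists G => H HG.
have GE s (o : option rat + (key * nat)) : (forall z, z \in s -> H z) ->
    H (G s (pickle o)) by exact: HG.
have sk_in s k i : (forall z, z \in s -> H z) -> H ((sk s k)`_i, 0).
  by move=> /(GE _ (inr (k, i))); rewrite /G pickleK.
split.
(* On the empty list both arguments take the default value 0. *)
- by have := GE [::] (inl (Some 0)); rewrite /G pickleK/= scaler0 addr0; apply.
- move=> q u v Hu Hv; have := GE [:: u; v] (inl (Some q)).
  by rewrite /G pickleK/=; apply => z; rewrite !inE => /orP[] /eqP ->.
- move=> u v Hu Hv; have := GE [:: u; v] (inl None).
  by rewrite /G pickleK/=; apply => z; rewrite !inE => /orP[] /eqP ->.
move=> s E eps eps0 sH.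
pose n := Num.truncn eps^-1.
have neps : n.+1%:R^-1 <= eps.
  by rewrite invf_ple ?posrE//; exact/ltW/truncnS_gt.
(* The sums make the key record additivity on [E]; the first components of [s] make it record which
   points stay fixed. *)
pose e := E ++ [seq x + y | x <- E, y <- E] ++ map fst s.
pose e' := sk s (tuple_key n s e).
have ee' : tuple_key n s e' = tuple_key n s e by exact: skP.
have [see' ikey] : size e' = size e /\ forall i, (i < size e)%N -> [/\
    Num.floor (`|e'`_i| * n.+1%:R) = Num.floor (`|e`_i| * n.+1%:R),
    [seq (z.1 == e'`_i, Num.floor (z.2 e'`_i * n.+1%:R)) | z : X * dual_space X <- s] =
      [seq (z.1 == e`_i, Num.floor (z.2 e`_i * n.+1%:R)) | z : X * dual_space X <- s] &
    forall j k, (j < size e)%N -> (k < size e)%N ->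
      (e'`_i + e'`_j == e'`_k) = (e`_i + e`_j == e`_k)].
  case: ee' => see'; rewrite see' => me; split=> // i im.
  have [-> -> mij] := mkseq_inj me im; split=> // j k jm km.
  by have /mkseq_inj := mkseq_inj mij jm; apply.
(* Outside [e] the index is [size e] and the value is the default 0; [sk_in] covers this case
   too. *)
pose T x := e'`_(index x e).
have Te x : x \in e -> exists i, [/\ (i < size e)%N, x = e`_i & T x = e'`_i].
  by move=> xe; exists (index x e); rewrite index_mem nth_index.
have Ee x : x \in E -> x \in e by move=> xE; rewrite mem_cat xE.
exists T; split.
- by move=> x; exists (T x, 0) => //; exact: sk_in.
- move=> z zs; have [|i [im ez ->]] := Te z.1.
    by rewrite !mem_cat (map_f fst zs) !orbT.
  have [_ /eq_in_map/(_ _ zs)[h _] _] := ikey i im.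
  by move: h; rewrite -ez eqxx => /eqP ->; rewrite subrr normr0 ltW.
- move=> z x zs xE; have [i [im -> ->]] := Te x (Ee _ xE).
  have [_ /eq_in_map/(_ _ zs)[_ h] _] := ikey i im.
  exact: le_trans (floor_eq_dist h) neps.
- move=> x xE; have [i [im -> ->]] := Te x (Ee _ xE).
  have [h _ _] := ikey i im.
  exact: le_trans (floor_eq_dist h) neps.
- move=> x y xE yE; have [i [im ex ->]] := Te x (Ee _ xE).
  have [j [jm ey ->]] := Te y (Ee _ yE).
  have [|k [km exy ->]] := Te (x + y).
    by rewrite !mem_cat allpairs_f ?orbT.
  have [_ _ /(_ j k jm km)] := ikey i im.
  by rewrite -ex -ey -exy eqxx => /eqP ->; rewrite subrr normr0 ltW.
Qed.

Definition ideal_family : set (set (X * dual_space X)) :=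
  [set A : set (X * dual_space X) | [/\ closed A, linear_subspace A,
    forall z z', A z -> A z' -> A (z.1, z'.2) & approx_ideal A]].

Lemma ideal_family_closure H : H 0 ->
  (forall (q : rat) u v, H u -> H v -> H (ratr q *: u + v)) ->
  (forall z z', H z -> H z' -> H (z.1, z'.2)) ->
  (forall s (d : R), 0 < d -> (forall z, z \in s -> closure H z) ->
    exists B, [/\ B `<=` closure H, approx_ideal B &
      forall z, z \in s -> exists2 y, B y & `|z - y| < d]) ->
  ideal_family (closure H).
Proof.
move=> H0 Hlin Hrect Hlim; split.
- exact: closed_closure.
- exact: closure_linear.
- exact: closed_rect.
- exact: approx_ideal_limit.
Qed.

Lemma exceedingly_rich_ideal_family : exceedingly_rich ideal_family.
Proof.
split; first by move=> A [].
- move=> Y; have [G GP] := ex_ideal_operations.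
  have [H [HG YH cH]] := ex_dens_closed_under G Y.
  have [H0 Hlin Hrect Hid] := GP H HG.
  exists (closure H); split=> //; apply: ideal_family_closure => // s d d0 sH.
  exists H; split=> //; first exact: subset_closure.
  by move=> z zs; exact: (closure_normP _ _).1 (sH z zs) d d0.
- move=> F FS [[A0 FA0] dirF].
  have FS0 A : F A -> A 0 by move=> /FS[_ [+ _] _ _]; rewrite inE.
  have join z z' : (\bigcup_(B in F) B) z -> (\bigcup_(B in F) B) z' ->
      exists A, [/\ F A, A z & A z'].
    move=> [A FA Az] [A' FA' Az']; have [B FB sB] := dirF _ _ FA FA'.
    by exists B; split=> //; apply: sB; [left|right].
  apply: ideal_family_closure.
  + by exists A0; rewrite //; exact: FS0.
  + move=> q u v uU vU; have [A [FA Au Av]] := join _ _ uU vU; exists A => //.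
    have [_ [_ linA] _ _] := FS _ FA.
    by have := linA (ratr q) u v; rewrite !inE; apply.
  + move=> u v uU vU; have [A [FA Au Av]] := join _ _ uU vU; exists A => //.
    by have [_ _ + _] := FS _ FA; apply.
  + move=> s d d0 sU.
    (* By induction on [s], directedness yields one member of [F] that approximates all of [s]. *)
    suff [B FB sB] : exists2 B, F B &
        forall z, z \in s -> exists2 y, B y & `|z - y| < d.
      exists B; split=> //; last by have [] := FS _ FB.
      by apply: subset_trans (@subset_closure _ _); exact: bigcup_sup.
    elim: s sU => [|z s IH] sU; first by exists A0.
    have [|B FB sB] := IH; first by move=> y ys; apply: sU; rewrite in_cons ys orbT.
    have [y [C FC Cy] zy] := (closure_normP _ _).1 (sU z (mem_head _ _)) d d0.
    have [D FD sD] := dirF _ _ FB FC; exists D => // x.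
    rewrite in_cons => /orP[/eqP ->|/sB[t Bt xt]].
    * by exists y => //; apply: sD; right.
    * by exists t => //; apply: sD; left.
Qed.

End rich_family.

(** * Limits along an ultrafilter of approximate retractions *)

Lemma ultra_bounded_cvg (R : realType) T (U : set_system T) (g : T -> R) (M : R) :
  UltraFilter U -> (\forall t \near U, `|g t| <= M) ->
  exists l : R, g t @[t --> U] --> l.
Proof.
move=> UU gM.
have UK : (g @ U) `[- M, M]%classic.
  by apply: filterS gM => t; rewrite ler_norml.
have [l [_ lU]] := @segment_compact R (- M) M (g @ U) _ UK.
exists l => B Bl; have [//|UB] := in_ultra_setVsetC (g @^-1` B) UU.
by have [t []] := lU (~` B) B UB Bl.
Qed.

Section limit_retraction.
Variables (R : realType) (X : normedModType R).

Definition limit_retraction (V : set X) (W : set (dual_space X))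
    (U : set_system (X -> X)) : Prop :=
  [/\ forall x, \forall T \near U, V (T x),
      forall x, `|T x| @[T --> U] --> `|x|,
      forall x, V x -> T x @[T --> U] --> x,
      forall (f : dual_space X) x, W f -> (f (T x) : R) @[T --> U] --> (f x : R) &
      forall x y, (T (x + y) - (T x + T y)) @[T --> U] --> (0 : X)].

(** The sets of approximate retractions generate a proper filter: each is nonempty, and the
    intersection of two contains the one for the concatenated lists and the smaller tolerance. Any
    ultrafilter above it works. *)
Lemma ex_limit_retraction (A : set (X * dual_space X)) : approx_ideal A ->
  exists2 U, UltraFilter U & limit_retraction (fst @` A) (snd @` A) U.
Proof.
move=> idA.
pose F : set_system (X -> X) := [set B | exists s E (eps : R), [/\ 0 < eps,
  forall z, z \in s -> A z & approx_retraction A s E eps `<=` B]].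
have FF : ProperFilter F.
  split.
    move=> [s [E [eps [eps0 sA sub]]]].
    by have [T /sub] := idA s E eps eps0 sA.
  split.
  - by exists [::], [::], 1.
  - move=> P Q [s [E [eps [eps0 sA sP]]]] [s' [E' [eps' [eps0' sA' sQ]]]].
    exists (s ++ s'), (E ++ E'), (Num.min eps eps'); split.
    + by rewrite lt_min eps0.
    + by move=> z; rewrite mem_cat => /orP[/sA|/sA'].
    + move=> T [h1 h2 h3 h4 h5]; split.
      * apply: sP; split=> // [z zs|z x zs xE|x xE|x y xE yE].
        - by have := h2 z; rewrite mem_cat zs le_min => /(_ erefl)/andP[].
        - by have := h3 z x; rewrite !mem_cat zs xE le_min => /(_ erefl erefl)/andP[].
        - by have := h4 x; rewrite !mem_cat xE le_min => /(_ erefl)/andP[].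
        - by have := h5 x y; rewrite !mem_cat xE yE le_min => /(_ erefl erefl)/andP[].
      * apply: sQ; split=> // [z zs|z x zs xE|x xE|x y xE yE].
        - by have := h2 z; rewrite mem_cat zs le_min orbT => /(_ erefl)/andP[].
        - by have := h3 z x; rewrite !mem_cat zs xE le_min !orbT => /(_ erefl erefl)/andP[].
        - by have := h4 x; rewrite !mem_cat xE le_min orbT => /(_ erefl)/andP[].
        - by have := h5 x y; rewrite !mem_cat xE yE le_min !orbT => /(_ erefl erefl)/andP[].
  - by move=> P Q PQ [s [E [eps [? ? sub]]]]; exists s, E, eps; split=> // T /sub/PQ.
have [U [UU FU]] := ultraFilterLemma FF.
have inU s E (eps : R) : 0 < eps -> (forall z, z \in s -> A z) ->
    \forall T \near U, approx_retraction A s E eps T.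
  by move=> eps0 sA; apply: FU; exists s, E, eps; split.
exists U => //; split.
- move=> x; apply: filterS (inU [::] [::] 1 ltr01 _) => // T [h _ _ _ _].
  exact: h.
- move=> x; apply/cvgrPdist_le => e e0.
  apply: filterS (inU [::] [:: x] e e0 _) => // T [_ _ _ h _].
  by rewrite distrC; apply: h; rewrite mem_head.
- move=> _ [z Az <-]; apply/cvgrPdist_le => e e0.
  apply: filterS (inU [:: z] [::] e e0 _) => [T [_ h _ _ _]|y].
    by rewrite distrC; apply: h; rewrite mem_head.
  by rewrite inE => /eqP ->.
- move=> _ x [z Az <-]; apply/cvgrPdist_le => e e0.
  apply: filterS (inU [:: z] [:: x] e e0 _) => [T [_ _ h _ _]|y].
    by rewrite distrC; apply: h; rewrite mem_head.
  by rewrite inE => /eqP ->.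
- move=> x y; apply/cvgr0Pnorm_le => e e0.
  apply: filterS (inU [::] [:: x; y] e e0 _) => // T [_ _ _ _ h].
  by apply: h; rewrite !inE eqxx ?orbT.
Qed.

Variables (V : set X) (W : set (dual_space X)) (U : set_system (X -> X)).
Hypotheses (UU : UltraFilter U) (limU : limit_retraction V W U).

Lemma limit_retraction0 : T 0 @[T --> U] --> (0 : X).
Proof.
have [_ h _ _ _] := limU; apply/cvgr0Pnorm_le => e e0.
by apply: cvgr_le (h 0) _ _; rewrite normr0.
Qed.

Lemma limit_retractionMn x n : (T (x *+ n) - T x *+ n) @[T --> U] --> (0 : X).
Proof.
have [_ _ _ _ h] := limU; elim: n => [|n IH].
  rewrite mulr0n; under eq_fun do rewrite mulr0n subr0.
  exact: limit_retraction0.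
rewrite -[X in _ --> X]addr0.
under eq_fun => T.
  rewrite !mulrS (_ : T (x + x *+ n) - (T x + T x *+ n) =
    (T (x + x *+ n) - (T x + T (x *+ n))) + (T (x *+ n) - T x *+ n)).
  over.
  by rewrite !opprD !addrA subrK.
by apply: cvgD; [exact: h|exact: IH].
Qed.

(* [c x] is compared with [(m / n) x] for a natural number [m] close to [n c]. *)
Lemma limit_retractionZ (c : R) x : (T (c *: x) - c *: T x) @[T --> U] --> (0 : X).
Proof.
have [_ hN _ _ hD] := limU.
(* For negative [c], the sum of the images of [c *: x] and [- c *: x] is asymptotically [T 0], which
   tends to 0. *)
wlog c0 : c / 0 <= c => [pos|].
  have [|c0] := leP 0 c; first exact: pos.
  have h1 := pos (- c) ltac:(by rewrite oppr_ge0 ltW).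
  rewrite -[X in _ --> X]oppr0.
  under eq_fun => T.
    rewrite (_ : T (c *: x) - c *: T x =
      - ((T (c *: x + (- c) *: x) - (T (c *: x) + T ((- c) *: x)))
      + (T ((- c) *: x) - (- c) *: T x) - T 0)); first over.
    rewrite -scalerDl subrr scale0r (scaleNr c (T x)) opprK (opprD (T (c *: x))) (addrA (T 0)) subrKA.
    by rewrite -(addrA (T 0)) (addrC (T 0)) addrK opprD opprK.
  have h2 := cvgN (cvgB (cvgD (hD (c *: x) ((- c) *: x)) h1) limit_retraction0).
  by rewrite addr0 subr0 in h2; exact: h2.
apply/cvgr0Pnorm_le => e e0.
(* Makes the norms of [z] and [r *: x] at most [e / 4] each. *)
pose n := (Num.truncn (4 * (`|x| + 1) / e)).+1.
have n0 : 0 < n%:R :> R by rewrite ltr0n.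
have n1 : 4 * (`|x| + 1) / e < n%:R by exact: truncnS_gt.
pose m := Num.truncn (n%:R * c).
have /andP[m1 m2] : m%:R <= n%:R * c < m.+1%:R.
  by apply: truncn_itv; rewrite mulr_ge0.
pose z := n%:R^-1 *: x; pose r := c - m%:R / n%:R.
have zn : z *+ n = x by rewrite /z -scaler_nat scalerA divff ?scale1r// gt_eqF.
have zr : z *+ m + r *: x = c *: x.
  by rewrite /z -scaler_nat scalerA -scalerDl /r addrC subrK.
(* Besides these two norms, the errors below add up to [(4 + c) * d]. *)
pose d := e / 2 / (4 + c).
have d0 : 0 < d by rewrite !divr_gt0//; lra.
have dc : d * (4 + c) = e / 2 by rewrite /d divfK//; lra.
have nz : `|z| = `|x| / n%:R by rewrite normrZ normfV normr_nat mulrC.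
have r01 : 0 <= r <= n%:R^-1.
  have -> : r = (n%:R * c - m%:R) / n%:R by rewrite /r; field; rewrite gt_eqF.
  rewrite divr_ge0 ?subr_ge0//= ler_pdivrMr// mulVf ?gt_eqF//.
  by rewrite lerBlDl -natr1 in m2 *; lra.
have nr : `|r *: x| <= `|x| / n%:R.
  by rewrite normrZ mulrC ler_wpM2l// ger0_norm; lra.
have xn : `|x| / n%:R <= e / 4.
  rewrite ler_pdivrMr//; move: n1; rewrite ltr_pdivrMr//; nra.
near=> T.
have t1 : `|T (z *+ n) - T z *+ n| <= d.
  by near: T; apply: (cvgr0Pnorm_le _).1 d0; exact: limit_retractionMn.
have t2 : `|T (z *+ m) - T z *+ m| <= d.
  by near: T; apply: (cvgr0Pnorm_le _).1 d0; exact: limit_retractionMn.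
have t3 : `|T (z *+ m + r *: x) - (T (z *+ m) + T (r *: x))| <= d.
  by near: T; apply: (cvgr0Pnorm_le _).1 d0; exact: hD.
have t4 : `|T (r *: x)| <= `|r *: x| + d.
  by near: T; apply: (cvgr_le _ (hN _)); rewrite ltrDl.
have t5 : `|T z| <= `|z| + d.
  by near: T; apply: (cvgr_le _ (hN _)); rewrite ltrDl.
rewrite zn in t1; rewrite zr in t3.
have -> : T (c *: x) - c *: T x = ((T (c *: x) - (T (z *+ m) + T (r *: x))) +
    (T (z *+ m) - T z *+ m) + T (r *: x)) + (m%:R - n%:R * c) *: T z
    - c *: (T x - T z *+ n).
  rewrite (addrAC _ (T (z *+ m) - _)) opprD (addrA (T (c *: x))) subrK subrKA.
  by rewrite scalerBl scaler_nat subrKA scalerBr -(scaler_nat n (T z)) scalerA (mulrC c) opprB addrA subrK.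
have k1 : `|(m%:R - n%:R * c) *: T z| <= `|z| + d.
  rewrite normrZ -[leRHS]mul1r; apply: ler_pM => //.
  by rewrite distrC ger0_norm ?subr_ge0// lerBlDl natr1 ltW.
have k2 : `|c *: (T x - T z *+ n)| <= c * d.
  by rewrite normrZ ger0_norm// ler_wpM2l.
apply: le_trans (ler_normB _ _) _.
apply: le_trans (lerD (le_trans (ler_normD _ _) (lerD (le_trans (ler_normD _ _)
  (lerD (le_trans (ler_normD _ _) (lerD t3 t2)) t4)) k1)) k2) _.
lra.
Unshelve. all: by end_near. Qed.
End limit_retraction.

(** * The projection on the dual space *)

Section limit_projection.
Variables (R : realType) (X : normedModType R).

Lemma ex_dual (g : X -> R) (M : R) :
  (forall (a : R) x y, g (a *: x + y) = a * g x + g y) ->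
  (forall x, `|g x| <= M * `|x|) -> exists f : dual_space X, forall x, f x = g x.
Proof.
move=> gl gM.
have lg : linear (g : X -> R^o) by exact: gl.
pose G : {linear X -> R^o} := HB.pack (g : X -> R^o) (GRing.isLinear.Build _ _ _ _ _ lg).
have cg : continuous (g : X -> R^o).
  apply: (@bounded_linear_continuous _ _ _ G); apply/linear_boundedP.
  near=> r => x; apply: le_trans (gM x) _; rewrite ler_wpM2r//; near: r.
have gc : (g : X -> R^o) \in @continuous_functional R X by apply/asboolP.
by exists (DualSpace gc).
Unshelve. all: by end_near. Qed.

Lemma dual_ext (f g : dual_space X) : (forall x, f x = g x) -> f = g.
Proof. by move=> fg; apply/val_inj/funext. Qed.

Lemma dual_linearE (f : dual_space X) (a : R) (x y : X) :
  f (a *: x + y) = a * f x + f y.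
Proof. exact: dual_linear. Qed.

Lemma dual_subr (f : dual_space X) (x y : X) : f (x - y) = f x - f y.
Proof. by rewrite -scaleN1r addrC dual_linearE mulN1r addrC. Qed.

Lemma dual0 (f : dual_space X) : f 0 = 0.
Proof. by rewrite -(subrr 0) dual_subr subrr. Qed.

Lemma dual_le (f : dual_space X) (M : R) : 0 <= M ->
  (forall x, `|f x| <= M * `|x|) -> `|f| <= M.
Proof.
move=> M0 fM; apply: opnorm_le; [exact: dual_linear|exact: dual_continuous|].
by move=> x x1; rewrite (le_trans (fM x))// ler_piMr.
Qed.

Variables (V : set X) (W : set (dual_space X)) (U : set_system (X -> X)).
Hypotheses (UU : UltraFilter U) (limU : limit_retraction V W U).

Lemma cvg_uniq (h : (X -> X) -> R) (a b : R) :
  h T @[T --> U] --> a -> h T @[T --> U] --> b -> a = b.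
Proof. exact: (cvg_unique (@norm_hausdorff _ R^o)). Qed.

Lemma cvg_near (h k : (X -> X) -> R) (a : R) : (\forall T \near U, h T = k T) ->
  h T @[T --> U] --> a -> k T @[T --> U] --> a.
Proof. by move=> hk; apply: cvg_trans; exact: near_eq_cvg. Qed.

Lemma dual_cvg0 (f : dual_space X) (h : (X -> X) -> X) :
  h T @[T --> U] --> (0 : X) -> (f (h T) : R) @[T --> U] --> (0 : R).
Proof.
move=> /cvgr0Pnorm_le h0; apply/cvgr0Pnorm_le => e e0.
have f1 : 0 < `|f| + 1 by rewrite ltr_wpDl.
near=> T; apply: le_trans (ler_dual f _) _.
apply: (@le_trans _ _ ((`|f| + 1) * (e / (`|f| + 1)))).
  apply: ler_pM => //; first by rewrite lerDl.
  by near: T; apply: h0; rewrite divr_gt0.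
by rewrite mulrC divfK// gt_eqF.
Unshelve. all: by end_near. Qed.

(* The projection sends [f] to the limit of [f \o T] along the ultrafilter. *)
Lemma ex_limit_dual (f : dual_space X) : exists g : dual_space X,
  `|g| <= `|f| /\ forall x, (f (T x) : R) @[T --> U] --> (g x : R).
Proof.
have [_ hN _ _ hD] := limU.
have /choice[g gP] : forall x, exists l : R, (f (T x) : R) @[T --> U] --> l.
  move=> x; apply: (@ultra_bounded_cvg _ _ _ _ (`|f| * (`|x| + 1))).
  near=> T; apply: le_trans (ler_dual f _) _; rewrite ler_wpM2l//.
  by near: T; apply: (cvgr_le _ (hN x)); rewrite ltrDl.
have gM x : `|g x| <= `|f| * `|x|.
  rewrite -subr_ge0.
  have h : (`|f| * `|T x| - `|f (T x) : R|) @[T --> U] --> `|f| * `|x| - `|g x|.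
    by apply: cvgB; [exact: cvgMl_tmp|exact: cvg_norm].
  apply: cvgr_to_ge h _; apply: nearW => T.
  by rewrite subr_ge0; exact: ler_dual.
(* [f] sends the additivity and homogeneity defects of [T] to 0 in the limit, and limits are
   unique. *)
have gl a x y : g (a *: x + y) = a * g x + g y.
  have h1 := dual_cvg0 f (hD (a *: x) y).
  have h2 := dual_cvg0 f (limit_retractionZ UU limU a x).
  have h3 := cvgD (cvgD h1 h2) (cvgD (cvgMl_tmp (gP x) : (a * f (T x)) @[T --> U] --> a * g x) (gP y)).
  rewrite !add0r in h3.
  apply: (cvg_uniq (gP _)).
  apply: cvg_near (h3 _ _ _ _); apply: nearW => T.
  rewrite !fctE !dual_subr.
  have := dual_linearE f 1 (T (a *: x)) (T y); rewrite scale1r mul1r => ->.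
  have := dual_linearE f a (T x) 0; rewrite addr0 dual0 addr0 => ->.
  ring.
have [k kE] := ex_dual gl gM.
exists k; split; last by move=> x; rewrite kE.
by apply: dual_le => // x; rewrite kE.
Unshelve. all: by end_near. Qed.

(** As [T x] eventually lies in [V], [P f] depends only on [f] on [V]; as [T x] tends to [x] for [x]
    in [V], [P f] agrees with [f] there. Together these give idempotence and the kernel, while each
    functional in [W] is its own image. *)
Lemma ex_limit_projection : exists P : {linear dual_space X -> dual_space X},
  [/\ contractive_projection P, P @^-1` [set 0] = annihilator V & W `<=` range P].
Proof.
have [VT hN hV hW hD] := limU.
have [P PP] := choice ex_limit_dual.
have PE (f g : dual_space X) x : (f (T x) : R) @[T --> U] --> (g x : R) -> P f x = g x.
  by move=> h; exact: cvg_uniq ((PP f).2 x) h.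
have lP : linear P.
  move=> a f g; apply: dual_ext => x.
  apply: (PE _ (a *: P f + P g)); apply: cvgD; last exact: (PP g).2.
  exact: cvgMl_tmp ((PP f).2 x).
have PV (f : dual_space X) x : V x -> P f x = f x.
  move=> Vx; apply: PE; have h := dual_cvg0 f.
  have /h{}h : (T x - x) @[T --> U] --> (0 : X).
    by rewrite -[X in _ --> X](subrr x); apply: cvgB (hV x Vx) (cvg_cst _).
  have h' := cvgD h (@cvg_cst _ (f x : R) _ U _).
  rewrite add0r in h'; apply: cvg_near (h' _ _); apply: nearW => T.
  by rewrite dual_subr subrK.
have Pext (f g : dual_space X) : (forall x, V x -> f x = g x) -> P f = P g.
  move=> fg; apply: dual_ext => x; apply: PE.
  apply: cvg_near ((PP g).2 x).
  by apply: filterS (VT x) => T Vx; rewrite fg.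
pose Q : {linear dual_space X -> dual_space X} :=
  HB.pack P (GRing.isLinear.Build _ _ _ _ _ lP).
have cQ : continuous Q.
  apply: bounded_linear_continuous; apply/linear_boundedP.
  near=> r => f; apply: le_trans (PP f).1 _; rewrite ler_peMl//; near: r.
exists Q; split.
- split; first exact: cQ.
    by apply/funext => f /=; apply: Pext => x Vx; exact: PV.
  apply: opnorm_le; [exact: (linearP Q)|exact: cQ|].
  by move=> f f1; exact: le_trans (PP f).1 f1.
- apply/seteqP; split=> f /=.
    by move=> Pf x Vx; rewrite -(PV f x Vx) [P f]Pf.
  move=> fV; rewrite -[RHS](linear0 Q) /=; apply: Pext => x Vx.
  by rewrite fV.
- move=> f Wf; exists f => //; apply: dual_ext => x.
  exact: PE (hW f x Wf).
Unshelve. all: by end_near. Qed.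

End limit_projection.

(** * Linear algebra and compactness in coordinates *)

Lemma ex_projector (F : fieldType) n (N : set 'rV[F]_n) : N 0 ->
  (forall (a : F) u v, N u -> N v -> N (a *: u + v)) ->
  exists p : 'M[F]_n, (forall u, N (u - u *m p)) /\ forall u, N u -> u *m p = 0.
Proof.
move=> N0 Nlin.
have NZ (a : F) u : N u -> N (a *: u) by move=> Nu; rewrite -[_ *: _]addr0; exact: Nlin.
have ND u v : N u -> N v -> N (u + v).
  by move=> Nu Nv; rewrite -[u]scale1r; exact: Nlin.
pose sub (M : 'M[F]_n) := forall u : 'rV_n, (u <= M)%MS -> N u.
pose P r := `[< exists2 M, sub M & \rank M = r >].
have P0 : exists r, P r.
  exists 0%N; apply/asboolP; exists 0; last exact: mxrank0.
  by move=> u; rewrite submx0 => /eqP ->.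
have Pn r : P r -> (r <= n)%N by move=> /asboolP[M _ <-]; exact: rank_leq_row.
(* A matrix of maximal rank with row space inside [N] has row space exactly [N]; [p] projects onto a
   complement along it. *)
case: (ex_maxnP P0 Pn) => _ /asboolP[M sM <-] maxM.
have NM u : N u -> (u <= M)%MS.
  move=> Nu; have MM : (M <= M + u)%MS by exact: addsmxSl.
  apply: submx_trans (addsmxSr M u) _.
  rewrite -(mxrank_leqif_sup MM) eqn_leq mxrankS//= maxM//.
  apply/asboolP; exists (M + u)%MS => // _ /sub_addsmxP[[w w'] /= ->].
  by apply: ND; [apply/sM/submxMl|rewrite [w']mx11_scalar mul_scalar_mx; exact: NZ].
exists (proj_mx M^C%MS M); split=> u.
  by apply: sM; apply: proj_mx_compl_sub; rewrite submx_full// addsmxC addsmx_compl_full.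
by move=> /NM; apply: proj_mx_0; rewrite capmxC capmx_compl.
Qed.

Section row_norm.
Variables (R : realType) (n : nat) (X : normedModType R).

Lemma coord_norm_le (d : 'rV[R]_n) i : `|d 0 i| <= `|d|.
Proof.
rewrite [leRHS]/Num.norm/= mx_normrE; apply/bigmax_geP; right => /=.
by exists (0, i).
Qed.

Lemma row_linear_le (g : {linear 'rV[R]_n -> X}) d :
  `|g d| <= `|d| * \sum_i `|g 'e_i|.
Proof.
rewrite {1}(row_sum_delta d) linear_sum mulr_sumr.
apply: le_trans (ler_norm_sum _ _ _) _; apply: ler_sum => i _.
by rewrite linearZ/= normrZ ler_wpM2r// coord_norm_le.
Qed.

End row_norm.

Lemma row_linear_continuous (R : realType) n (X : normedModType R)
  (g : {linear 'rV[R]_n -> X}) : continuous g.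
Proof.
apply: bounded_linear_continuous; apply/linear_boundedP.
near=> r => d; apply: le_trans (row_linear_le g d) _.
by rewrite mulrC ler_wpM2r//; near: r.
Unshelve. all: by end_near. Qed.

(** Pointwise convergence becomes uniform on the compact set because the maps are eventually
    equi-Lipschitz, the norms of the images of the basis vectors being convergent. *)
Lemma near_almost_isometry (R : realType) n (X : normedModType R) T
    (U : set_system T) (h : T -> {linear 'rV[R]_n -> X}) (g : {linear 'rV[R]_n -> X})
    (K : set 'rV[R]_n) (eps : R) : Filter U -> compact K ->
  (forall c, K c -> g c != 0) ->
  (forall c, `|h t c| @[t --> U] --> `|g c|) -> 0 < eps ->
  \forall t \near U, forall c, K c ->
    (1 + eps)^-1 * `|g c| <= `|h t c| <= (1 + eps) * `|g c|.
Proof.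
move=> FU /compact_near_coveringP cK gK hg eps0.
apply: (cK _ U (fun t c =>
  (1 + eps)^-1 * `|g c| <= `|h t c| <= (1 + eps) * `|g c|)) => c Kc.
pose a := `|g c|; have a0 : 0 < a by rewrite normr_gt0 gK.
(* Near [c], the norm of [g c'] is within [eta] of [a] and that of [h t c'] within [2 * eta]; in the
   worst case the lower bound reads [eta * (3 + 2 * eps) <= eps * a]. *)
pose eta := eps * a / (3 + 2 * eps).
have eta0 : 0 < eta by rewrite divr_gt0 ?mulr_gt0//; lra.
have etaE : eta * (3 + 2 * eps) = eps * a by rewrite /eta divfK//; lra.
have ee0 : 0 <= eta * eps by rewrite mulr_ge0// ltW.
(* A common Lipschitz constant for [g] and eventually for [h t]; the final 1 makes it positive even
   for [n = 0]. *)
pose C := \sum_i (`|g 'e_i| + 1) + 1.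
have gC : \sum_i `|g 'e_i| <= C.
  by rewrite /C -[leLHS]addr0 lerD// ler_sum// => i _; rewrite lerDl.
have C0 : 0 < C by rewrite ltr_wpDl// sumr_ge0// => i _; rewrite addr_ge0.
near=> c' t => /=.
have dc : `|c' - c| * C <= eta.
  rewrite -ler_pdivlMr// distrC ltW//; near: c'.
  have e0 : 0 < eta / C by rewrite divr_gt0.
  by have := nbhsx_ballx c _ e0; rewrite -ball_normE.
have hC : \sum_i `|h t 'e_i| <= C.
  apply: (@le_trans _ _ (\sum_i (`|g 'e_i| + 1))); last by rewrite lerDl.
  apply: ler_sum => i _; move: i.
  near: t; apply: filter_forall => i.
  by apply: (cvgr_le _ (hg _)); rewrite ltrDl.
have hca : `| `|h t c| - a| <= eta.
  rewrite distrC; near: t; have /cvgrPdist_le := hg c; exact.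
have gd : `|g c' - g c| <= eta.
  rewrite -linearB; apply: le_trans (row_linear_le _ _) _.
  by apply: le_trans dc; rewrite ler_wpM2l.
have hd : `|h t c' - h t c| <= eta.
  rewrite -linearB; apply: le_trans (row_linear_le _ _) _.
  by apply: le_trans dc; rewrite ler_wpM2l.
have k1 := le_trans (lerB_dist (g c') (g c)) gd.
have k2 := le_trans (lerB_dist (g c) (g c')) (eq_ind_r (fun z => z <= eta) gd (distrC (g c) (g c'))).
have k3 := le_trans (lerB_dist (h t c') (h t c)) hd.
have k4 := le_trans (lerB_dist (h t c) (h t c'))
  (eq_ind_r (fun z => z <= eta) hd (distrC (h t c) (h t c'))).
rewrite -/a in k1 k2; move: hca; rewrite ler_norml => /andP[k5 k6].
have e1 : 0 < 1 + eps by lra.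
by rewrite ler_pdivrMl//; apply/andP; split; nra.
Unshelve. all: by end_near. Qed.

(** * Almost isometric ideals from limit retractions *)

Section ideal.
Variables (R : realType) (X : normedModType R).
Variables (V : set X) (W : set (dual_space X)) (U : set_system (X -> X)).
Hypotheses (UU : UltraFilter U) (limU : limit_retraction V W U).

Lemma limit_retraction_sum n (e : 'I_n -> X) (c : 'rV[R]_n) :
  (T (\sum_i c 0 i *: e i) - \sum_i c 0 i *: T (e i)) @[T --> U] --> (0 : X).
Proof.
have [_ _ _ _ hD] := limU.
elim: (index_enum _) => [|i r IH].
  rewrite !big_nil; under eq_fun do rewrite !big_nil subr0.
  exact: limit_retraction0 UU limU.
rewrite big_cons (_ : (fun T : X -> X => _) = fun T =>
    (T (c 0 i *: e i + \sum_(j <- r) c 0 j *: e j) -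
      (T (c 0 i *: e i) + T (\sum_(j <- r) c 0 j *: e j))) +
    (T (c 0 i *: e i) - c 0 i *: T (e i)) +
    (T (\sum_(j <- r) c 0 j *: e j) - \sum_(j <- r) c 0 j *: T (e j))); last first.
  apply/funext => T; rewrite big_cons; set S := \sum_(_ <- r) _.
  by rewrite -[RHS]addrA (addrACA (T (c 0 i *: e i))) -opprD subrKA.
rewrite -[X in _ --> X]addr0 -[X in _ --> X + _]addr0.
apply: cvgD; last exact: IH.
by apply: cvgD; [exact: hD|exact: (limit_retractionZ UU limU)].
Qed.

(** [T] is only asymptotically linear, so just its values at the [e i] are kept, extended linearly
    in the coordinates and corrected to fix vectors of [V]. The resulting [h T] vanishes on linear
    relations, hence descends to [E], and for some [T] it is close enough to an isometry. *)
Lemma limit_retraction_ideal : closed V -> linear_subspace V ->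
  almost_isometric_ideal V.
Proof.
move=> cV lV; split=> // E [n [e ->]] eps eps0.
have [VT hN hV _ hD] := limU.
have V0 : V 0 by case: lV; rewrite inE.
have Vlin (a : R) x y : V x -> V y -> V (a *: x + y).
  by move=> Vx Vy; have [_ /(_ a x y)] := lV; rewrite !inE; apply.
have VZ (a : R) x : V x -> V (a *: x).
  by move=> Vx; rewrite -[_ *: _]addr0; exact: Vlin.
have VD x y : V x -> V y -> V (x + y).
  by move=> Vx Vy; rewrite -[x]scale1r; exact: Vlin.
pose comb (v : 'I_n -> X) (c : 'rV[R]_n) := \sum_i c 0 i *: v i.
have comb_lin v : linear (comb v).
  move=> a c d; rewrite /comb scaler_sumr -big_split /=; apply: eq_bigr => i _.
  by rewrite !mxE scalerDl scalerA.
pose L v : {linear 'rV[R]_n -> X} :=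
  HB.pack (comb v) (GRing.isLinear.Build _ _ _ _ _ (comb_lin v)).
have LE v c : L v c = \sum_i c 0 i *: v i by [].
(* [p] removes the coefficients of vectors that must stay fixed, [k] those of
   linear relations between the [e i]: the sphere of the range of [k] is compact
   and [L e] does not vanish on it. *)
have [||p [pN p0]] := @ex_projector _ n [set c | V (L e c)].
- by rewrite /mkset linear0.
- by move=> a c d; rewrite /mkset => Vc Vd; rewrite linearP; exact: Vlin.
have [||k [kN k0]] := @ex_projector _ n [set c | L e c = 0].
- by rewrite /mkset linear0.
- by move=> a c d; rewrite /mkset => c0 d0; rewrite linearP c0 d0 scaler0 addr0.
(* The coefficients [c - c *m p] give a vector already in [V], which is left alone; only [c *m p]
   goes through [T]. *)
pose h (T : X -> X) : {linear 'rV[R]_n -> X} :=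
  (L e \o (idfun \- mulmxr p)) \+ (L (T \o e) \o mulmxr p).
have hE T c : h T c = L e (c - c *m p) + L (T \o e) (c *m p) by [].
have hV0 T c : V (L e c) -> h T c = L e c.
  by move=> Vc; rewrite hE p0// subr0 linear0 addr0.
have h0 T c : L e c = 0 -> h T c = 0.
  by move=> c0; rewrite hV0 c0.
(* [h T c] is asymptotically [T (L e c)], by additivity and since [T] nearly fixes the part in
   [V]. *)
have hlim c : `|h T c| @[T --> U] --> `|L e c|.
  have h1 := limit_retraction_sum e (c *m p).
  have h2 := hV _ (pN c).
  have h3 := hD (L e (c - c *m p)) (L e (c *m p)).
  have h4 := hN (L e c).
  have e1 : L e (c - c *m p) + L e (c *m p) = L e c by rewrite -linearD subrK.
  rewrite e1 in h3.
  apply/cvgrPdist_le => d d0; have d4 : 0 < d / 4 by rewrite divr_gt0.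
  near=> T.
  have t1 : `|T (L e (c *m p)) - L (T \o e) (c *m p)| <= d / 4.
    by near: T; move/cvgr0Pnorm_le : h1; exact.
  have t2 : `|L e (c - c *m p) - T (L e (c - c *m p))| <= d / 4.
    by near: T; move/cvgrPdist_le : h2; exact.
  have t3 : `|T (L e c) - (T (L e (c - c *m p)) + T (L e (c *m p)))| <= d / 4.
    by near: T; move/cvgr0Pnorm_le : h3; exact.
  have t4 : `| `|L e c| - `|T (L e c)| | <= d / 4.
    by near: T; move/cvgrPdist_le : h4; exact.
  have t5 : `|T (L e c) - h T c| <= d / 4 + d / 4 + d / 4.
    have -> : T (L e c) - h T c =
        (T (L e c) - (T (L e (c - c *m p)) + T (L e (c *m p))))
        + (T (L e (c *m p)) - L (T \o e) (c *m p))
        - (L e (c - c *m p) - T (L e (c - c *m p))).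
      rewrite hE opprB -[RHS]addrA (addrACA (T (L e (c *m p)))) -opprD.
      by rewrite (addrC (T (L e (c *m p)))) subrKA (addrC (L e _)).
    apply: le_trans (ler_normB _ _) (lerD (le_trans (ler_normD _ _) (lerD t3 t1)) t2).
  have t6 := le_trans (ler_dist_dist (T (L e c)) (h T c)) t5.
  move: t4 t6; rewrite !ler_norml => /andP[? ?] /andP[? ?]; lra.
pose K := [set c : 'rV[R]_n | c *m k = c /\ `|c| = 1].
have cK : compact K.
  apply: bounded_closed_compact.
    by apply: filterS (nbhs_pinfty_ge (num_real 1)) => M M1 c [_ c1] /=; rewrite c1.
  pose q : {linear 'rV[R]_n -> 'rV[R]_n} := mulmxr k \- idfun.
  have -> : K = (q @^-1` [set 0]) `&` ((fun c => `|c|) @^-1` [set x | x = 1]).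
    apply/seteqP; split=> c /= [c1 c2]; split=> //.
      by rewrite c1 subrr.
    by apply/eqP; rewrite -subr_eq0; apply/eqP.
  apply: closedI.
    apply: preimage_closed => [c _|]; first exact: row_linear_continuous.
    by apply: accessible_closed_set1; exact: hausdorff_accessible.
  apply: preimage_closed => [c _|]; first exact: norm_continuous.
  exact: closed_eq.
have gK c : K c -> L e c != 0.
  move=> [ck c1]; apply/eqP => /k0; rewrite ck => c0.
  by move: c1; rewrite c0 normr0 => /eqP; rewrite eq_sym oner_eq0.
have nearU : \forall T \near U, (forall i, V (T (e i))) /\ forall c, K c ->
    (1 + eps)^-1 * `|L e c| <= `|h T c| <= (1 + eps) * `|L e c|.
  near=> T; split.
    by near: T; apply: filter_forall => i; exact: VT.
  by near: T; exact: near_almost_isometry.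
have [T [TV TK]] := filter_ex nearU.
(* Chooses coordinates for each point of [E]; the value of [h T] is independent of the choice, by
   [h0]. *)
have /choice[sel selP] : forall x, exists c, (exists c', L e c' = x) -> L e c = x.
  move=> x; have [[c cx]|no] := pselect (exists c', L e c' = x).
    by exists c.
  by exists 0 => /no.
have hsel c : h T (sel (L e c)) = h T c.
  apply/eqP; rewrite -subr_eq0 -linearB; apply/eqP/h0.
  by rewrite linearB selP ?subrr//; exists c.
(* Replacing [c] by [c *m k] changes it by a relation, invisible to [L e] and [h T]; rescaling then
   brings a nonzero result into [K]. *)
have hiso c : (1 + eps)^-1 * `|L e c| <= `|h T c| <= (1 + eps) * `|L e c|.
  have hk : L e (c - c *m k) = 0 by exact: kN.
  have eL : L e c = L e (c *m k).
    by apply/eqP; rewrite -subr_eq0 -linearB hk.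
  have eh : h T c = h T (c *m k).
    by apply/eqP; rewrite -subr_eq0 -linearB h0.
  rewrite eL eh; set d := c *m k.
  have [->|d0] := eqVneq d 0; first by rewrite !linear0 !normr0 !mulr0 lexx.
  have dk : d *m k = d.
    apply/esym/eqP; rewrite -subr_eq0 -mulmxBl k0 ?eqxx//.
  have nd : 0 < `|d| by rewrite normr_gt0.
  have := TK (`|d|^-1 *: d); rewrite !linearZ/= !normrZ normfV normr_id => h1.
  have /h1 : K (`|d|^-1 *: d).
    split; first by rewrite -scalemxAl dk.
    by rewrite normrZ normfV normr_id mulVf// gt_eqF.
  rewrite !(mulrCA _ `|d|^-1) !ler_pM2l ?invr_gt0//.
have inE c : exists c', L e c' = \sum_(i < n) c i *: e i.
  by exists (\row_i c i); rewrite LE; apply: eq_bigr => i _; rewrite mxE.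
exists (fun x => h T (sel x)); split.
- split.
    move=> a _ _ [c _ <-] [d _ <-].
    have [c' <-] := inE c; have [d' <-] := inE d.
    by rewrite -linearP !hsel linearP.
  exists (1 + eps) => _ [c _ <-]; have [c' <-] := inE c.
  by rewrite hsel; have /andP[] := hiso c'.
- move=> _ [c _ <-]; have [c' <-] := inE c; rewrite hsel hE.
  apply: (VD); first exact: pN.
  by rewrite LE; apply: (big_ind V V0 VD) => i _; exact/VZ/TV.
- move=> _ [[c _ <-]]; have [c' <-] := inE c; move=> Vc.
  by rewrite hsel hV0.
- by move=> _ [c _ <-]; have [c' <-] := inE c; rewrite hsel; exact: hiso.
Unshelve. all: by end_near. Qed.

End ideal.

Theorem theorem1 (R : realType) (X : completeNormedModType R) :
  exists S : set (set (X * dual_space X)),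
    [/\ forall A, S A -> closed A /\ linear_subspace A,
        rectangular S,
        exceedingly_rich S &
        forall (V : set X) (W : set (dual_space X)), S (V `*` W) ->
          almost_isometric_ideal V /\
          exists P : {linear dual_space X -> dual_space X},
            [/\ contractive_projection P,
                P @^-1` [set 0] = annihilator V &
                W `<=` range P]].
Proof.
exists (@ideal_family R X); split.
- by move=> A [].
- move=> A [_ _ rectA _]; exists (fst @` A), (snd @` A).
  apply/seteqP; split=> [z Az|[_ _] [/= [z Az <-] [z' Az' <-]]].
    by split; exists z.
  exact: rectA.
- exact: exceedingly_rich_ideal_family.
- move=> V W [cVW lVW _ idVW].
  have [V0 W0] : V 0 /\ W 0 by case: lVW => + _; rewrite inE => -[].
  have fstVW : fst @` (V `*` W) = V.
    by apply/seteqP; split=> [_ [z [Vz _] <-]//|x Vx]; exists (x, 0).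
  have sndVW : snd @` (V `*` W) = W.
    by apply/seteqP; split=> [_ [z [_ Wz] <-]//|f Wf]; exists (0, f).
  (* [V] inherits closedness, and below linearity, as the slice of the product at the zero
     functional. *)
  have cV : closed V.
    move=> x xV; suff [] : (V `*` W) (x, 0) by [].
    apply: cVW; apply/closure_normP => e e0.
    have [y Vy xy] := (closure_normP _ _).1 xV e e0.
    exists (y, 0) => //; rewrite prod_normE/= gt_max xy.
    by rewrite subrr normr0.
  have lV : linear_subspace V.
    split; first by rewrite inE.
    move=> a x y; rewrite !inE => Vx Vy.
    have [_ /(_ a (x, 0) (y, 0))] := lVW; rewrite !inE => h.
    by case: h.
  have [U UU limU] := ex_limit_retraction idVW.
  rewrite fstVW sndVW in limU.
  split; first exact: limit_retraction_ideal UU limU cV lV.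
  exact: ex_limit_projection UU limU.
Qed.
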